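(* Fix one of the twelve cases (1)–(12) below, and let $A=(a_{ij})$, $B=(b_{ij})$ be real $2\times2$ payoff tables satisfying the equations of that case and otherwise generic (i.e. lying outside some proper Zariski-closed subset of the real variety of payoff pairs defined by the equations of that case). Then every irreducible component of the Spohn variety $\mathcal V_X\subset\mathbb P^3_{\mathbb C}$ contains a smooth point with real coordinates; consequently, the set of real points of $\mathcal V_X$ is Zariski dense in $\mathcal V_X$. The cases are: (1) $a_{11}=a_{12}$; (2) $a_{11}=a_{21}$; (3) $a_{21}=a_{22}$; (4) $b_{11}=b_{12}$; (5) $b_{11}=b_{21}$; (6) $b_{12}=b_{22}$; (7) $a_{12}=a_{22}$ and $b_{21}=b_{22}$; (8) $a_{12}=a_{21}$ and $b_{12}=b_{21}$; (9) $0=a_{12}(b_{12}-b_{22})+a_{21}(b_{22}-b_{21})+a_{22}(b_{21}-b_{12})=a_{11}(b_{22}-b_{12})+a_{21}(b_{11}-b_{22})+a_{22}(b_{12}-b_{11})=a_{11}(b_{22}-b_{21})+a_{12}(b_{11}-b_{22})+a_{22}(b_{21}-b_{11})$; (10) $0=a_{11}(b_{12}-b_{21})+a_{12}(b_{21}-b_{22})+a_{21}(b_{22}-b_{12})=a_{12}(b_{11}-b_{21})+a_{21}(b_{12}-b_{11})+a_{22}(b_{21}-b_{12})=a_{11}(b_{11}-b_{21})+a_{21}(b_{22}-b_{11})+a_{22}(b_{21}-b_{22})$; (11) $0=a_{12}(b_{22}-b_{21})+a_{21}(b_{12}-b_{22})+a_{22}(b_{21}-b_{12})=a_{11}(b_{22}-b_{21})+a_{21}(b_{11}-b_{22})+a_{22}(b_{21}-b_{11})=a_{11}(b_{22}-b_{12})+a_{12}(b_{11}-b_{22})+a_{22}(b_{12}-b_{11})$;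 (12) $0=a_{11}(b_{12}-b_{21})+a_{12}(b_{22}-b_{12})+a_{21}(b_{21}-b_{22})=a_{12}(b_{11}-b_{12})+a_{21}(b_{21}-b_{11})+a_{22}(b_{12}-b_{21})=a_{11}(b_{11}-b_{21})+a_{12}(b_{22}-b_{12})+a_{21}(b_{21}-b_{11})+a_{22}(b_{12}-b_{22})$.
   Context: For a $2\times2$ game $X$ with payoff tables $A=(a_{ij})$ (player 1) and $B=(b_{ij})$ (player 2), the Spohn variety is $\mathcal V_X=\mathbb V(\det M_1,\det M_2)\subset\mathbb P^3_{\mathbb C}$ with homogeneous coordinates $[p_{11}:p_{12}:p_{21}:p_{22}]$, where $\det M_1=(a_{21}-a_{11})p_{11}p_{21}+(a_{22}-a_{11})p_{11}p_{22}+(a_{21}-a_{12})p_{12}p_{21}+(a_{22}-a_{12})p_{12}p_{22}$ and $\det M_2=(b_{12}-b_{11})p_{11}p_{12}+(b_{22}-b_{11})p_{11}p_{22}+(b_{12}-b_{21})p_{12}p_{21}+(b_{22}-b_{21})p_{21}p_{22}$ (these are the determinants of $M_1=\begin{bmatrix}p_{11}+p_{12}& a_{11}p_{11}+a_{12}p_{12}\\ p_{21}+p_{22}& a_{21}p_{21}+a_{22}p_{22}\end{bmatrix}$ and $M_2=\begin{bmatrix}p_{11}+p_{21}& b_{11}p_{11}+b_{21}p_{21}\\ p_{12}+p_{22}& b_{12}p_{12}+b_{22}p_{22}\end{bmatrix}$). *)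

(* Defs.v *)
From HB Require Import structures.
From mathcomp Require Import all_boot all_order all_algebra.
From mathcomp Require Import reals.
From mathcomp Require Import complex.
From mathcomp Require Import mpoly.

Set Implicit Arguments.
Unset Strict Implicit.
Unset Printing Implicit Defensive.

Import Order.TTheory GRing.Theory Num.Theory.
Local Open Scope ring_scope.
Local Open Scope complex_scope.

Section Spohn.
Variable R : realType.

Local Notation C := (R[i]).

Definition e11 (A : 'M[R]_2) : R := A ord0 ord0.
Definition e12 (A : 'M[R]_2) : R := A ord0 ord_max.
Definition e21 (A : 'M[R]_2) : R := A ord_max ord0.
Definition e22 (A : 'M[R]_2) : R := A ord_max ord_max.

(** Homogeneous coordinates [p11 : p12 : p21 : p22] are the variables
    'X_0, 'X_1, 'X_2, 'X_3 of {mpoly C[4]}. *)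
Definition X11 : {mpoly C[4]} := 'X_(inord 0).
Definition X12 : {mpoly C[4]} := 'X_(inord 1).
Definition X21 : {mpoly C[4]} := 'X_(inord 2).
Definition X22 : {mpoly C[4]} := 'X_(inord 3).

Definition cst (r : R) : {mpoly C[4]} := (r%:C)%:MP.

Definition detM1 (A : 'M[R]_2) : {mpoly C[4]} :=
    cst (e21 A - e11 A) * X11 * X21 + cst (e22 A - e11 A) * X11 * X22
  + cst (e21 A - e12 A) * X12 * X21 + cst (e22 A - e12 A) * X12 * X22.

Definition detM2 (B : 'M[R]_2) : {mpoly C[4]} :=
    cst (e12 B - e11 B) * X11 * X12 + cst (e22 B - e11 B) * X11 * X22
  + cst (e12 B - e21 B) * X12 * X21 + cst (e22 B - e21 B) * X21 * X22.

(** Points of P^3_C are represented by nonzero vectors of C^4; all subsets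
    of P^3 below are predicates on vectors that only contain nonzero vectors
    and (being Zariski closed) are invariant under nonzero scaling. *)
Definition pt := {ffun 'I_4 -> C}.

Definition zclosed (X : pt -> Prop) : Prop :=
  exists S : {mpoly C[4]} -> Prop,
    (forall f, S f -> exists d, f \is d.-homog) /\
    (forall v, X v <-> (v != 0 /\ forall f, S f -> f.@[v] = 0)).

Definition subsetP3 (X Y : pt -> Prop) : Prop := forall v, X v -> Y v.

Definition zirreducible (X : pt -> Prop) : Prop :=
  zclosed X /\ (exists v, X v) /\
  forall Y Z, zclosed Y -> zclosed Z ->
    subsetP3 X (fun v => Y v \/ Z v) -> subsetP3 X Y \/ subsetP3 X Z.

Definition irr_component (V X : pt -> Prop) : Prop :=
  zirreducible X /\ subsetP3 X V /\
  forall Y, zirreducible Y -> subsetP3 X Y -> subsetP3 Y V -> subsetP3 Y X.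

Definition spohn_var (A B : 'M[R]_2) (v : pt) : Prop :=
  v != 0 /\ (detM1 A).@[v] = 0 /\ (detM2 B).@[v] = 0.

Definition spohn_jacobian (A B : 'M[R]_2) (v : pt) : 'M[C]_(2, 4) :=
  \matrix_(i < 2, j < 4)
     ((if i == ord0 then detM1 A else detM2 B)^`M(j)).@[v].

(** Smooth point of V_X (Jacobian criterion for the complete intersection
    V(det M1, det M2)). *)
Definition spohn_smooth (A B : 'M[R]_2) (v : pt) : Prop :=
  spohn_var A B v /\ \rank (spohn_jacobian A B v) = 2%N.

(** A point with real coordinates (for some representative). *)
Definition real_pt (v : pt) : Prop := forall j, exists r : R, v j = r%:C.

Definition real_zdense (V : pt -> Prop) : Prop :=
  forall Z, zclosed Z -> subsetP3 (fun v => V v /\ real_pt v) Z -> subsetP3 V Z.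

Definition payoff_vec (A B : 'M[R]_2) : 'I_8 -> R :=
  fun i => nth 0 [:: e11 A; e12 A; e21 A; e22 A; e11 B; e12 B; e21 B; e22 B]
               (nat_of_ord i).

(** The twelve cases (1)-(12); case (k+1) is [spohn_case k]. *)
Definition spohn_case (k : 'I_12) (A B : 'M[R]_2) : Prop :=
  let a11 := e11 A in let a12 := e12 A in let a21 := e21 A in let a22 := e22 A in
  let b11 := e11 B in let b12 := e12 B in let b21 := e21 B in let b22 := e22 B in
  match nat_of_ord k with
  | 0%N => a11 = a12
  | 1%N => a11 = a21
  | 2%N => a21 = a22
  | 3%N => b11 = b12
  | 4%N => b11 = b21
  | 5%N => b12 = b22
  | 6%N => a12 = a22 /\ b21 = b22
  | 7%N => a12 = a21 /\ b12 = b21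
  | 8%N =>
      a12 * (b12 - b22) + a21 * (b22 - b21) + a22 * (b21 - b12) = 0 /\
      a11 * (b22 - b12) + a21 * (b11 - b22) + a22 * (b12 - b11) = 0 /\
      a11 * (b22 - b21) + a12 * (b11 - b22) + a22 * (b21 - b11) = 0
  | 9%N =>
      a11 * (b12 - b21) + a12 * (b21 - b22) + a21 * (b22 - b12) = 0 /\
      a12 * (b11 - b21) + a21 * (b12 - b11) + a22 * (b21 - b12) = 0 /\
      a11 * (b11 - b21) + a21 * (b22 - b11) + a22 * (b21 - b22) = 0
  | 10%N =>
      a12 * (b22 - b21) + a21 * (b12 - b22) + a22 * (b21 - b12) = 0 /\
      a11 * (b22 - b21) + a21 * (b11 - b22) + a22 * (b21 - b11) = 0 /\
      a11 * (b22 - b12) + a12 * (b11 - b22) + a22 * (b12 - b11) = 0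
  | _ =>
      a11 * (b12 - b21) + a12 * (b22 - b12) + a21 * (b21 - b22) = 0 /\
      a12 * (b11 - b12) + a21 * (b21 - b11) + a22 * (b12 - b21) = 0 /\
      a11 * (b11 - b21) + a12 * (b22 - b12) + a21 * (b21 - b11)
        + a22 * (b12 - b22) = 0
  end.

End Spohn.

(* Main.v *)
Require Import Defs.
From HB Require Import structures.
From mathcomp Require Import all_boot all_order all_algebra.
From mathcomp Require Import reals.
From mathcomp Require Import complex.
From mathcomp Require Import mpoly.
From mathcomp Require Import ring lra.
From Stdlib Require Import Classical.
Import Order.TTheory GRing.Theory Num.Theory.
Local Open Scope ring_scope.

(** In each case the Spohn variety is a union of at most three rational curves
    (lines, conics and twisted cubics), each the image of a polynomial map
    [Phi : C^2 -> C^4] with real coefficients.  The closure of such an image is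
    irreducible, so every irreducible component of the variety is the closure of
    one of the images, and any real parameter at which the Jacobian has rank 2
    gives a smooth real point on it.  Density holds because a polynomial in two
    variables that vanishes at all real parameters is zero.

    Both equations are bilinear: with [(x, y, z, w) = (p11, p12, p21, p22)],
    [det M1] is bilinear in [(x, y)] and [(z, w)], and [det M2] in [(x, z)] and
    [(y, w)].  Exchanging [y] and [z] exchanges the two players, which reduces
    cases (4)-(6) to (2), (1), (3). *)

(** Without dimension theory, a point missed by the parametrized curves could itself be a component,
    so the curves have to cover every complex point and not merely a dense set. The obstacle is
    where solving for the remaining coordinates would divide by zero, by a linear form [L] or a
    product [f g]. Clearing these denominators gives homogeneous parametrizations; they still reach
    the excluded points as long as certain binary forms have no common zero. Genericity therefore
    means that the resultants of these forms, and a few coefficients, do not vanish: the polynomial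
    [g] of each case is a product of coefficients and of factors of these resultants, and an
    explicit pair of tables shows that it is not zero on the whole case. Two parameters serve
    instead of one because they range over the affine cone over [P^1], so no point at infinity is
    lost. The parameters that exhibit smoothness mostly give coordinate points, where most entries
    of the Jacobian vanish. *)

Lemma exists_nonroot (D : idomainType) (g : nat -> D) (p : {poly D}) :
  injective g -> p != 0 -> exists n, p.[g n] != 0.
Proof.
move=> inj_g p0; apply: NNPP => noroot.
have root_g n : root p (g n).
  by apply/rootP/eqP/negPn/negP => pn; apply: noroot; exists n.
have := @max_poly_roots D p (map g (iota 0 (size p))) p0.
rewrite size_map size_iota ltnn map_inj_uniq // iota_uniq => H.
suff: false by [].
by apply: H => //; apply/allP => x /mapP[n _ ->].
Qed.

(** * Closures of parametrized curves, irreducible components and density of real points *)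

Section Criterion.
Variable R : realType.
Local Open Scope complex_scope.
Local Notation C := (R[i]).

(** Curves are kept as plain functions so that identities between them are within reach of [ring].
    The constructor [eq_realpoly] closes the class under pointwise equality, in place of functional
    extensionality. *)
Inductive realpoly : (C -> C -> C) -> Prop :=
| realpoly_fst : realpoly (fun s _ => s)
| realpoly_snd : realpoly (fun _ t => t)
| realpoly_cst (r : R) : realpoly (fun _ _ => r%:C)
| realpolyD F G : realpoly F -> realpoly G -> realpoly (fun s t => F s t + G s t)
| realpolyM F G : realpoly F -> realpoly G -> realpoly (fun s t => F s t * G s t)
| realpolyN F : realpoly F -> realpoly (fun s t => - F s t)
| eq_realpoly F G : (forall s t, F s t = G s t) -> realpoly F -> realpoly G.

Lemma realpoly_real F : realpoly F ->
  forall s t : R, exists r : R, F s%:C t%:C = r%:C.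
Proof.
move=> pF s t; elim: pF => [||r|F' G _ [a ->] _ [b ->]|F' G _ [a ->] _ [b ->]|F' _ [a ->]|F' G <- _ //].
- by exists s.
- by exists t.
- by exists r.
- by exists (a + b); rewrite rmorphD.
- by exists (a * b); rewrite rmorphM.
- by exists (- a); rewrite rmorphN.
Qed.

(** Here [t] is the outer variable and [s] the inner one. Iterated univariate polynomials form an
    integral domain, which is what irreducibility of the closures rests on. *)
Definition horner2 (s t : C) : {poly {poly C}} -> C :=
  horner_eval s \o horner_eval t%:P.

HB.instance Definition _ s t := GRing.RMorphism.on (horner2 s t).

Lemma horner2C s t c : horner2 s t c%:P%:P = c.
Proof. by rewrite /horner2 /= /horner_eval !hornerC. Qed.

Lemma realpoly_horner F : realpoly F ->
  exists P : {poly {poly C}}, forall s t, F s t = horner2 s t P.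
Proof.
elim=> [||r|F' G _ [P eP] _ [Q eQ]|F' G _ [P eP] _ [Q eQ]|F' _ [P eP]|F' G eFG _ [P eP]].
- by exists 'X%:P => s t; rewrite /horner2 /= /horner_eval hornerC hornerX.
- by exists 'X => s t; rewrite /horner2 /= /horner_eval hornerX hornerC.
- by exists r%:C%:P%:P => s t; rewrite horner2C.
- by exists (P + Q) => s t; rewrite rmorphD eP eQ.
- by exists (P * Q) => s t; rewrite rmorphM eP eQ.
- by exists (- P) => s t; rewrite rmorphN eP.
- by exists P => s t; rewrite -eFG eP.
Qed.

(** The natural numbers are infinitely many real values: one of them is a nonroot for the outer
    variable over the domain [{poly C}], then another for the inner variable over [C]. *)
Lemma horner2_neq0 (P : {poly {poly C}}) :
  P != 0 -> exists s t : R, horner2 s%:C t%:C P != 0.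
Proof.
have injn : injective (fun n : nat => n%:R : C).
  by move=> i j /eqP; rewrite eqr_nat => /eqP.
have injP : injective (fun n : nat => (n%:R : C)%:P) by move=> i j /polyC_inj/injn.
move=> /(exists_nonroot _ _ _ injP)[j] /(exists_nonroot _ _ _ injn)[i Pij].
by exists i%:R, j%:R; rewrite !rmorph_nat.
Qed.

Lemma meval_horner2 (Phi : C -> C -> pt R) (f : {mpoly C[4]}) :
  (forall i, realpoly (fun s t => Phi s t i)) ->
  exists P : {poly {poly C}}, forall s t, f.@[Phi s t] = horner2 s t P.
Proof.
move=> polyPhi.
have [P eP] : exists P : 'I_4 -> {poly {poly C}},
    forall i s t, Phi s t i = horner2 s t (P i).
  exact: fin_all_exists (fun i => realpoly_horner _ (polyPhi i)).
exists (mmap (polyC \o polyC) P f) => s t.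
rewrite mevalE /mmap rmorph_sum; apply: eq_bigr => m _.
rewrite rmorphM rmorph_prod; congr (_ * _).
  by rewrite /= horner2C.
by apply: eq_bigr => i _; rewrite rmorphXn eP.
Qed.

Lemma meval_scale (f : {mpoly C[4]}) d (c : C) (v w : pt R) :
  f \is d.-homog -> (forall i, v i = c * w i) -> f.@[v] = c ^+ d * f.@[w].
Proof.
move=> /dhomogP homf vw; rewrite !mevalE big_distrr /=.
rewrite big_seq [RHS]big_seq; apply: eq_bigr => m /homf /= dm.
rewrite mulrCA; congr (_ * _).
rewrite -dm mdegE -prodrXr -big_split /=.
by apply: eq_bigr => i _; rewrite vw exprMn.
Qed.

Lemma dhomog_detM1 (A : 'M[R]_2) : detM1 A \is 2.-homog.
Proof.
have X1 i : ('X_i : {mpoly C[4]}) \is 1.-homog by rewrite dhomogX /= mdeg1.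
have K c : cst (R := R) c \is 0.-homog by rewrite /cst -alg_mpolyC dhomogZ ?dhomog1.
by rewrite /detM1 !(@dhomogD _ _ _ 2) // !(@dhomogM _ _ _ 1 _ 1) ?(@dhomogM _ _ _ 0 _ 1) ?X1 ?K.
Qed.

Lemma dhomog_detM2 (B : 'M[R]_2) : detM2 B \is 2.-homog.
Proof.
have X1 i : ('X_i : {mpoly C[4]}) \is 1.-homog by rewrite dhomogX /= mdeg1.
have K c : cst (R := R) c \is 0.-homog by rewrite /cst -alg_mpolyC dhomogZ ?dhomog1.
by rewrite /detM2 !(@dhomogD _ _ _ 2) // !(@dhomogM _ _ _ 1 _ 1) ?(@dhomogM _ _ _ 0 _ 1) ?X1 ?K.
Qed.

(** The Zariski closure of the projective image. Parameters with [Phi s t = 0] do no harm in the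
    quantification: there, only nonzero constants fail to vanish. *)
Definition curve_closure (Phi : C -> C -> pt R) (v : pt R) : Prop :=
  v != 0 /\ forall f d, f \is d.-homog -> (forall s t, f.@[Phi s t] = 0) -> f.@[v] = 0.

Lemma curve_closureP (Phi : C -> C -> pt R) s t : Phi s t != 0 -> curve_closure Phi (Phi s t).
Proof. by move=> nz; split=> // f d _; apply. Qed.

Lemma zclosed_curve_closure (Phi : C -> C -> pt R) : zclosed (curve_closure Phi).
Proof.
exists (fun f => (exists d, f \is d.-homog) /\ forall s t, f.@[Phi s t] = 0).
split=> [f []//|v]; split=> [[nz H]|[nz H]]; split=> //.
  by move=> f [[d hf] f0]; apply: H hf f0.
by move=> f d hf f0; apply: H; split=> //; exists d.
Qed.

(** If neither [Y] nor [Z] contains the closure, an equation of each pulls back to a nonzero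
    polynomial in the parameters. Where the product of the two is nonzero, the curve has a point
    outside both sets. *)
Lemma zirreducible_curve_closure (Phi : C -> C -> pt R) :
  (forall i, realpoly (fun s t => Phi s t i)) -> (exists s t, Phi s t != 0) ->
  zirreducible (curve_closure Phi).
Proof.
move=> polyPhi [s0 [t0 nz0]]; split; first exact: zclosed_curve_closure.
split; first by exists (Phi s0 t0); apply: curve_closureP.
move=> Y Z [SY [hY eY]] [SZ [hZ eZ]] sub.
have nonvanish (X : pt R -> Prop) (S : {mpoly C[4]} -> Prop) :
    (forall f, S f -> exists d, f \is d.-homog) ->
    (forall v, X v <-> v != 0 /\ forall f, S f -> f.@[v] = 0) ->
    ~ subsetP3 (curve_closure Phi) X ->
    exists2 P, P != 0 & forall s t, X (Phi s t) -> horner2 s t P = 0.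
  move=> hX eX nsub; apply: NNPP => noP; apply: nsub => v [nzv Hv].
  apply/eX; split=> // f Sf; have [d hf] := hX _ Sf; apply: Hv (hf) _ => s t.
  have [P eP] := meval_horner2 _ f polyPhi.
  apply/eqP/negPn/negP => fst; apply: noP; exists P => [|s' t' /eX[_ X0]].
    by apply: contraNneq fst => P0; rewrite eP P0 rmorph0.
  by rewrite -eP X0.
apply: NNPP => /not_or_and[/(nonvanish _ _ hY eY)[P P0 HP] /(nonvanish _ _ hZ eZ)[Q Q0 HQ]].
have [i nzi] : exists i, Phi s0 t0 i != 0.
  apply/existsP; move: nz0; apply: contraNT; rewrite negb_exists => /forallP H.
  by apply/eqP/ffunP => i; rewrite ffunE; apply/eqP/negPn.
(* The extra factor [T], a coordinate of [Phi], avoids the parameters at which [Phi] is the zero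
   vector and defines no projective point. *)
have [T eT] := realpoly_horner _ (polyPhi i).
have T0 : T != 0 by apply: contraNneq nzi => T0; rewrite eT T0 rmorph0.
have /horner2_neq0[s [t]] : P * Q * T != 0 by rewrite !mulf_neq0.
rewrite !rmorphM !mulf_eq0 !negb_or => /andP[/andP[nP nQ] nT].
have /sub[/HP/eqP|/HQ/eqP] : curve_closure Phi (Phi s%:C t%:C).
- by apply: curve_closureP; apply: contraNneq nT => e0; rewrite -[X in X == _]eT e0 ffunE.
- by rewrite (negPf nP).
- by rewrite (negPf nQ).
Qed.

Lemma zclosed_union (X Y : pt R -> Prop) :
  zclosed X -> zclosed Y -> zclosed (fun v => X v \/ Y v).
Proof.
move=> [S [hS eS]] [T [hT eT]].
exists (fun h => exists f g, [/\ S f, T g & h = f * g]); split.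
  move=> _ [f [g [/hS[d hf] /hT[e hg] ->]]].
  by exists (d + e)%N; apply: dhomogM.
move=> v; split.
  case=> [/eS[nz H]|/eT[nz H]]; split=> // _ [f [g [Sf Tg ->]]].
    by rewrite mevalM H // mul0r.
  by rewrite mevalM [X in _ * X]H // mulr0.
move=> [nz H]; apply: NNPP => /not_or_and[nX nY].
have [f Sf f0] : exists2 f, S f & f.@[v] != 0.
  apply: NNPP => nf; apply: nX; apply/eS; split=> // f Sf.
  by apply/eqP/negPn/negP => f0; apply: nf; exists f.
have [g Tg g0] : exists2 g, T g & g.@[v] != 0.
  apply: NNPP => nf; apply: nY; apply/eT; split=> // g Tg.
  by apply/eqP/negPn/negP => g0; apply: nf; exists g.
have /eqP : (f * g).@[v] = 0 by apply: H; exists f, g.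
by rewrite mevalM mulf_eq0 (negPf f0) (negPf g0).
Qed.

Lemma zclosed0 : zclosed (fun _ : pt R => False).
Proof.
exists (eq 1); split=> [_ <- |v]; first by exists 0%N; apply: dhomog1.
by split=> [[]|[_ /(_ _ erefl)/eqP]]; rewrite ?meval1 ?oner_eq0.
Qed.

Lemma zclosed_bigunion n (Xs : nat -> pt R -> Prop) :
  (forall i, zclosed (Xs i)) -> zclosed (fun v => exists2 i, (i < n)%N & Xs i v).
Proof.
move=> cXs; elim: n => [|n IHn].
  have [S [hS eS]] := zclosed0; exists S; split=> // v; rewrite -eS.
  by split=> [[]|].
have [S [hS eS]] := zclosed_union _ _ IHn (cXs n); exists S; split=> // v.
rewrite -eS; split.
  move=> [j]; rewrite ltnS leq_eqVlt => /predU1P[-> Xn|ljn Xj]; first by right.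
  by left; exists j.
by case=> [[i lin Xi]|Xn]; [exists i => //; apply: ltnW | exists n].
Qed.

Lemma zirreducible_bigunion n (Xs : nat -> pt R -> Prop) X :
  zirreducible X -> (forall i, zclosed (Xs i)) ->
  (forall v, X v -> exists2 i, (i < n)%N & Xs i v) ->
  exists2 i, (i < n)%N & subsetP3 X (Xs i).
Proof.
move=> [cX [[v0 Xv0] irrX]] cXs; elim: n => [/(_ _ Xv0)[]//|n IHn sub].
have [] := irrX _ _ (zclosed_bigunion n _ cXs) (cXs n).
- move=> v /sub[j]; rewrite ltnS leq_eqVlt => /predU1P[-> Xn|ljn Xj]; first by right.
  by left; exists j.
- by case/IHn=> i lin; exists i => //; apply: ltnW.
- by exists n.
Qed.

(** The third clause also ensures that no [Phi k] is identically zero; the scalar [c] in the last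
    one accounts for the choice of representative. *)
Definition real_uniformization (A B : 'M[R]_2) n (Phi : nat -> C -> C -> pt R) :=
  [/\ forall k i, (k < n)%N -> realpoly (fun s t => Phi k s t i),
      forall k s t, (k < n)%N ->
        (detM1 A).@[Phi k s t] = 0 /\ (detM2 B).@[Phi k s t] = 0,
      forall k, (k < n)%N -> exists s t : R, spohn_smooth A B (Phi k s%:C t%:C)
    & forall v, spohn_var A B v -> exists k s t (c : C),
        (k < n)%N /\ forall i, v i = c * Phi k s t i].

Lemma real_uniformization_dense A B n Phi :
  real_uniformization A B n Phi ->
  (forall X, irr_component (spohn_var A B) X ->
     exists v, X v /\ spohn_smooth A B v /\ real_pt v) /\
  real_zdense (spohn_var A B).
Proof.
move=> [polyPhi onV smoothPhi cover].
have realPhi k (s t : R) : (k < n)%N -> real_pt (Phi k s%:C t%:C).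
  by move=> lkn i; apply: (realpoly_real _ (polyPhi k i lkn)).
split=> [X [irrX [XV maxX]]|Z [S [hS eS]] realZ v /[dup] -[nzv _] /cover[k [s [t [c [lkn ev]]]]]].
  have [k lkn XC] : exists2 k, (k < n)%N & subsetP3 X (curve_closure (Phi k)).
    apply: zirreducible_bigunion irrX _ _ => [k|v /XV Vv].
      exact: zclosed_curve_closure.
    have [k [s [t [c [lkn ev]]]]] := cover _ Vv; exists k => //; split.
      by case: Vv.
    by move=> f d hf f0; rewrite (meval_scale _ _ _ _ _ hf ev) f0 mulr0.
  have [s [t smst]] := smoothPhi k lkn; exists (Phi k s%:C t%:C).
  split; last by split=> //; apply: realPhi.
  have nz : Phi k s%:C t%:C != 0 by case: smst => -[].
  apply: (maxX _ _ XC); last exact: curve_closureP.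
    by apply: zirreducible_curve_closure => [i|]; [apply: polyPhi | exists s%:C, t%:C].
  move=> v [nzv Cv]; split=> //; split.
    by apply: (Cv _ _ (dhomog_detM1 A)) => s' t'; case: (onV k s' t').
  by apply: (Cv _ _ (dhomog_detM2 B)) => s' t'; case: (onV k s' t').
apply/eS; split=> // f Sf; have [d hf] := hS _ Sf.
rewrite (meval_scale _ _ _ _ _ hf ev).
suff -> : f.@[Phi k s t] = 0 by rewrite mulr0.
have [P eP] := meval_horner2 _ f (fun i => polyPhi k i lkn).
have [s0 [t0 [[nz0 _] _]]] := smoothPhi k lkn.
have [i nzi] : exists i, Phi k s0%:C t0%:C i != 0.
  apply/existsP; move: nz0; apply: contraNT; rewrite negb_exists => /forallP H.
  by apply/eqP/ffunP => i; rewrite ffunE; apply/eqP/negPn.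
have [T eT] := realpoly_horner _ (polyPhi k i lkn).
have T0 : T != 0 by apply: contraNneq nzi => T0; rewrite eT T0 rmorph0.
(* [P] vanishes at every real parameter where [Phi k] is nonzero, and [T] vanishes at the other
   ones. Hence [P * T] has no real nonroot, which forces [P = 0]. *)
rewrite eP; suff -> : P = 0 by rewrite rmorph0.
apply/eqP/negPn/negP => P0.
have /horner2_neq0[s1 [t1]] : P * T != 0 by rewrite mulf_neq0.
rewrite rmorphM mulf_eq0 negb_or => /andP[/eqP nP nT]; apply: nP.
have nz1 : Phi k s1%:C t1%:C != 0 by apply: contraNneq nT => e0; rewrite -[X in X == _]eT e0 ffunE.
have /realZ/eS[_] : spohn_var A B (Phi k s1%:C t1%:C) /\ real_pt (Phi k s1%:C t1%:C).
  by split; [split=> //; apply: onV | apply: realPhi].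
by move/(_ f Sf); rewrite eP.
Qed.

End Criterion.

Arguments realpoly {R}.

(** * Reduction to two bilinear forms and four coordinate functions *)

Section Coordinates.
Variable R : realType.
Local Open Scope complex_scope.
Local Notation C := (R[i]).

Record coefs := Coefs {c11 : R; c12 : R; c21 : R; c22 : R}.

Definition bil (m : coefs) (x y z w : C) : C :=
  (c11 m)%:C * x * z + (c12 m)%:C * x * w + (c21 m)%:C * y * z + (c22 m)%:C * y * w.

Definition coefs1 (A : 'M[R]_2) : coefs :=
  Coefs (e21 A - e11 A) (e22 A - e11 A) (e21 A - e12 A) (e22 A - e12 A).

Definition coefs2 (B : 'M[R]_2) : coefs :=
  Coefs (e12 B - e11 B) (e22 B - e11 B) (e12 B - e21 B) (e22 B - e21 B).

Lemma detM1E A (v : pt R) : (detM1 A).@[v] =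
  bil (coefs1 A) (v (inord 0)) (v (inord 1)) (v (inord 2)) (v (inord 3)).
Proof. by rewrite /detM1 /cst /X11 /X12 /X21 /X22 !mevalD !mevalM !mevalC !mevalXU. Qed.

Lemma detM2E B (v : pt R) : (detM2 B).@[v] =
  bil (coefs2 B) (v (inord 0)) (v (inord 2)) (v (inord 1)) (v (inord 3)).
Proof.
rewrite /detM2 /cst /X11 /X12 /X21 /X22 !mevalD !mevalM !mevalC !mevalXU /bil /=.
by ring.
Qed.

Definition mk4 (x y z w : C) : pt R := [ffun i : 'I_4 => nth 0 [:: x; y; z; w] i].

Lemma mk4E x y z w : [/\ mk4 x y z w (inord 0) = x, mk4 x y z w (inord 1) = y,
  mk4 x y z w (inord 2) = z & mk4 x y z w (inord 3) = w].
Proof. by rewrite !ffunE !inordK. Qed.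

Lemma forall_I4 (P : 'I_4 -> Prop) :
  P (inord 0) -> P (inord 1) -> P (inord 2) -> P (inord 3) -> forall i, P i.
Proof.
move=> P0 P1 P2 P3 j; rewrite -[j]inord_val.
by case: j => -[|[|[|[|]]]].
Qed.

(* The gradients of the two quadrics, written out, are linearly independent. *)
Definition smooth4 (m n : coefs) (x y z w : C) : Prop := forall a b : C,
  a * ((c11 m)%:C * z + (c12 m)%:C * w) + b * ((c11 n)%:C * y + (c12 n)%:C * w) = 0 ->
  a * ((c21 m)%:C * z + (c22 m)%:C * w) + b * ((c11 n)%:C * x + (c21 n)%:C * z) = 0 ->
  a * ((c11 m)%:C * x + (c21 m)%:C * y) + b * ((c21 n)%:C * y + (c22 n)%:C * w) = 0 ->
  a * ((c12 m)%:C * x + (c22 m)%:C * y) + b * ((c12 n)%:C * x + (c22 n)%:C * z) = 0 ->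
  a = 0 /\ b = 0.

Lemma meval_mderivXU (i j : 'I_4) (v : pt R) :
  (('X_i : {mpoly C[4]})^`M(j)).@[v] = (i == j)%:R.
Proof.
rewrite mderivX mnm1E mevalZ; have [->|] := eqVneq i j; last by rewrite mul0r.
have -> : (U_(j) - U_(j))%MM = 0%MM by apply/mnmP => k; rewrite mnmBE mnm0E subnn.
by rewrite mul1r mpolyX0 meval1.
Qed.

Lemma meval_mderiv_quad (r : R) (i k j : 'I_4) (v : pt R) :
  ((cst r * 'X_i * 'X_k)^`M(j)).@[v] =
  r%:C * ((i == j)%:R * v k + v i * (k == j)%:R).
Proof.
rewrite /cst -mulrA mderiv_mulC mderivM mevalM mevalD !mevalM mevalC.
by rewrite !meval_mderivXU !mevalXU.
Qed.

Lemma meval_mderiv_quad4 (a b c d : R) (i1 i2 i3 i4 k1 k2 k3 k4 j : 'I_4) (v : pt R) :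
  ((cst a * 'X_i1 * 'X_k1 + cst b * 'X_i2 * 'X_k2 + cst c * 'X_i3 * 'X_k3
    + cst d * 'X_i4 * 'X_k4)^`M(j)).@[v] =
  a%:C * ((i1 == j)%:R * v k1 + v i1 * (k1 == j)%:R)
  + b%:C * ((i2 == j)%:R * v k2 + v i2 * (k2 == j)%:R)
  + c%:C * ((i3 == j)%:R * v k3 + v i3 * (k3 == j)%:R)
  + d%:C * ((i4 == j)%:R * v k4 + v i4 * (k4 == j)%:R).
Proof. by rewrite 3!mderivD 3!mevalD 4!meval_mderiv_quad. Qed.

Lemma spohn_jacobian1 A B (j : 'I_4) (v : pt R) (x := inord 0) (y := inord 1)
    (z := inord 2) (w := inord 3) :
  spohn_jacobian A B v ord0 j =
  (c11 (coefs1 A))%:C * ((x == j)%:R * v z + v x * (z == j)%:R)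
  + (c12 (coefs1 A))%:C * ((x == j)%:R * v w + v x * (w == j)%:R)
  + (c21 (coefs1 A))%:C * ((y == j)%:R * v z + v y * (z == j)%:R)
  + (c22 (coefs1 A))%:C * ((y == j)%:R * v w + v y * (w == j)%:R).
Proof. by rewrite mxE; exact: meval_mderiv_quad4. Qed.

Lemma spohn_jacobian2 A B (j : 'I_4) (v : pt R) (x := inord 0) (y := inord 1)
    (z := inord 2) (w := inord 3) :
  spohn_jacobian A B v (lift ord0 ord0) j =
  (c11 (coefs2 B))%:C * ((x == j)%:R * v y + v x * (y == j)%:R)
  + (c12 (coefs2 B))%:C * ((x == j)%:R * v w + v x * (w == j)%:R)
  + (c21 (coefs2 B))%:C * ((y == j)%:R * v z + v y * (z == j)%:R)
  + (c22 (coefs2 B))%:C * ((z == j)%:R * v w + v z * (w == j)%:R).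
Proof. by rewrite mxE; exact: meval_mderiv_quad4. Qed.

Lemma spohn_smooth_mk4 A B x y z w :
  bil (coefs1 A) x y z w = 0 -> bil (coefs2 B) x z y w = 0 ->
  smooth4 (coefs1 A) (coefs2 B) x y z w -> spohn_smooth A B (mk4 x y z w).
Proof.
have [v0 v1 v2 v3] := mk4E x y z w.
move=> q1 q2 sm; split.
  rewrite /spohn_var detM1E detM2E v0 v1 v2 v3; split=> //.
  apply/eqP => v00; move: v0 v1 v2 v3; rewrite v00 !ffunE => x0 y0 z0 w0.
  (* Both gradients vanish at the zero vector, so [a = b = 1] would satisfy all four equations. *)
  have := sm 1 1; rewrite -x0 -y0 -z0 -w0 !(mulr0, addr0) => /(_ erefl erefl erefl erefl)[/eqP].
  by rewrite oner_eq0.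
apply/eqP; rewrite -[_ == _]/(row_free _) -kermx_eq0.
apply/eqP/row_matrixP => i; rewrite row0.
set r := row i _; have : r *m spohn_jacobian A B (mk4 x y z w) = 0.
  by apply/sub_kermxP/row_sub.
move: r => r eq0.
have eqj j := congr1 (fun M : 'rV[C]_4 => M 0 j) eq0.
have ij (k l : nat) : (k < 4)%N -> (l < 4)%N -> (inord k == inord l :> 'I_4) = (k == l).
  by move=> hk hl; rewrite -val_eqE /= !inordK.
have [] := sm (r 0 ord0) (r 0 (lift ord0 ord0)).
- move: (eqj (inord 0)); rewrite !mxE !big_ord_recl big_ord0.
  by rewrite spohn_jacobian1 spohn_jacobian2 !ij // v0 v1 v2 v3 /= => <-; ring.
- move: (eqj (inord 1)); rewrite !mxE !big_ord_recl big_ord0.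
  by rewrite spohn_jacobian1 spohn_jacobian2 !ij // v0 v1 v2 v3 /= => <-; ring.
- move: (eqj (inord 2)); rewrite !mxE !big_ord_recl big_ord0.
  by rewrite spohn_jacobian1 spohn_jacobian2 !ij // v0 v1 v2 v3 /= => <-; ring.
- move: (eqj (inord 3)); rewrite !mxE !big_ord_recl big_ord0.
  by rewrite spohn_jacobian1 spohn_jacobian2 !ij // v0 v1 v2 v3 /= => <-; ring.
move=> r0 r1; apply/rowP => k; rewrite mxE.
by case: (unliftP ord0 k) => [j ->|-> //]; rewrite ord1.
Qed.

Record curve4 := Curve4 {cX : C -> C -> C; cY : C -> C -> C; cZ : C -> C -> C; cW : C -> C -> C}.

Definition good_curve (m n : coefs) (c : curve4) : Prop :=
  [/\ [/\ realpoly (cX c), realpoly (cY c), realpoly (cZ c) & realpoly (cW c)],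
      forall s t, bil m (cX c s t) (cY c s t) (cZ c s t) (cW c s t) = 0 /\
                  bil n (cX c s t) (cZ c s t) (cY c s t) (cW c s t) = 0
    & exists s t : R, smooth4 m n (cX c s%:C t%:C) (cY c s%:C t%:C) (cZ c s%:C t%:C) (cW c s%:C t%:C)].

(** The value [l = 0] is allowed, so the zero vector is hit too and covering statements need not
    exclude it. *)
Definition hits (c : curve4) x y z w : Prop :=
  exists s t l, [/\ x = l * cX c s t, y = l * cY c s t, z = l * cZ c s t & w = l * cW c s t].

Definition uniformized (m n : coefs) : Prop := exists (N : nat) (c : nat -> curve4),
  (forall k, (k < N)%N -> good_curve m n (c k)) /\
  (forall x y z w, bil m x y z w = 0 -> bil n x z y w = 0 ->
     exists2 k, (k < N)%N & hits (c k) x y z w).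

Lemma uniformized_swap m n : uniformized m n -> uniformized n m.
Proof.
move=> [N [c [goodc cover]]].
exists N, (fun k => Curve4 (cX (c k)) (cZ (c k)) (cY (c k)) (cW (c k))); split=> [k lkN|].
  have [[pX pY pZ pW] onV [s [t sm]]] := goodc k lkN; split=> /= [|s' t'|].
  - by split.
  - by have [] := onV s' t'.
  exists s, t => a b E0 E1 E2 E3.
  by have [| | | |-> ->] := sm b a; rewrite // addrC.
move=> x y z w q1 q2; have [k lkN [s [t [l [-> -> -> ->]]]]] := cover x z y w q2 q1.
by exists k => //; exists s, t, l.
Qed.

Lemma uniformized2 m n c1 c2 : good_curve m n c1 -> good_curve m n c2 ->
  (forall x y z w, bil m x y z w = 0 -> bil n x z y w = 0 ->
     hits c1 x y z w \/ hits c2 x y z w) -> uniformized m n.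
Proof.
(* The default value of [nth] serves as the last curve of the family. *)
move=> good1 good2 cover; exists 2%N, (nth c2 [:: c1]); split=> [[|[|]]//|x y z w q1 q2].
by case: (cover x y z w q1 q2) => hit; [exists 0%N | exists 1%N].
Qed.

Lemma uniformized3 m n c1 c2 c3 :
  good_curve m n c1 -> good_curve m n c2 -> good_curve m n c3 ->
  (forall x y z w, bil m x y z w = 0 -> bil n x z y w = 0 ->
     [\/ hits c1 x y z w, hits c2 x y z w | hits c3 x y z w]) -> uniformized m n.
Proof.
move=> good1 good2 good3 cover.
exists 3%N, (nth c3 [:: c1; c2]); split=> [[|[|[|]]]//|x y z w q1 q2].
by case: (cover x y z w q1 q2) => hit; [exists 0%N | exists 1%N | exists 2%N].
Qed.

Lemma uniformized_dense A B : uniformized (coefs1 A) (coefs2 B) ->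
  (forall X, irr_component (spohn_var A B) X ->
     exists v, X v /\ spohn_smooth A B v /\ real_pt v) /\
  real_zdense (spohn_var A B).
Proof.
move=> [N [c [goodc cover]]].
apply: (@real_uniformization_dense R A B N
  (fun k s t => mk4 (cX (c k) s t) (cY (c k) s t) (cZ (c k) s t) (cW (c k) s t))).
split=> [k i lkN|k s t lkN|k lkN|v [nzv []]].
- have [[pX pY pZ pW] _ _] := goodc k lkN.
  move: i; apply: forall_I4.
  + by apply: eq_realpoly pX => s t; rewrite ffunE inordK.
  + by apply: eq_realpoly pY => s t; rewrite ffunE inordK.
  + by apply: eq_realpoly pZ => s t; rewrite ffunE inordK.
  + by apply: eq_realpoly pW => s t; rewrite ffunE inordK.
- have [_ /(_ s t)[q1 q2] _] := goodc k lkN.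
  by rewrite detM1E detM2E !ffunE !inordK.
- have [_ onV [s [t sm]]] := goodc k lkN; exists s, t.
  by apply: spohn_smooth_mk4 => //; case: (onV s%:C t%:C).
rewrite detM1E detM2E => q1 q2.
have [k lkN [s [t [l [ex ey ez ew]]]]] := cover _ _ _ _ q1 q2.
exists k, s, t, l; split=> //.
by apply: forall_I4; rewrite !ffunE !inordK.
Qed.

End Coordinates.

(** * Rational parametrization of conics and twisted cubics over a field *)

Section RationalCurves.
Variable F : fieldType.

(** The last hypothesis is about the resultant of the two forms: the quadratic one evaluated at the
    root [(l2, - l1)] of the linear one. *)
Lemma linear_quadratic_zero (l1 l2 a b c u w : F) :
  l1 * u + l2 * w = 0 -> a * (u * u) + b * (u * w) + c * (w * w) = 0 ->
  a * (l2 * l2) - b * (l1 * l2) + c * (l1 * l1) != 0 -> u = 0 /\ w = 0.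
Proof.
move=> lin quad nz; split.
  apply/eqP; suff: u * u * (a * (l2 * l2) - b * (l1 * l2) + c * (l1 * l1)) == 0.
    by rewrite !mulf_eq0 (negPf nz) orbF orbb.
  apply/eqP; transitivity (l2 * l2 * (a * (u * u) + b * (u * w) + c * (w * w))
    + (l1 * u + l2 * w) * (c * (l1 * u - l2 * w) - b * l2 * u)); first by ring.
  by rewrite lin quad mulr0 mul0r addr0.
apply/eqP; suff: w * w * (a * (l2 * l2) - b * (l1 * l2) + c * (l1 * l1)) == 0.
  by rewrite !mulf_eq0 (negPf nz) orbF orbb.
apply/eqP; transitivity (l1 * l1 * (a * (u * u) + b * (u * w) + c * (w * w))
  + (l1 * u + l2 * w) * (a * (l2 * w - l1 * u) - b * l1 * w)); first by ring.
by rewrite lin quad mulr0 mul0r addr0.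
Qed.

(** Projection of the conic from its point [u = w = 0]: the line of direction [(s, t)] through this
    point meets the conic in one further point, found by solving for [z]. *)
Lemma conic_param (l1 l2 a b c u w z : F) :
  z * (l1 * u + l2 * w) + (a * (u * u) + b * (u * w) + c * (w * w)) = 0 ->
  a * (l2 * l2) - b * (l1 * l2) + c * (l1 * l1) != 0 ->
  exists s t r, [/\ u = r * (s * (l1 * s + l2 * t)), w = r * (t * (l1 * s + l2 * t))
    & z = r * - (a * (s * s) + b * (s * t) + c * (t * t))].
Proof.
move=> eq0 nz; have [L0|Ln0] := eqVneq (l1 * u + l2 * w) 0.
  move: eq0; rewrite L0 mulr0 add0r => q0.
  have [-> ->] := linear_quadratic_zero l1 l2 a b c u w L0 q0 nz.
  (* The centre of projection itself is reached along its tangent, the root of the linear form. *)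
  exists l2, (- l1), (- z / (a * (l2 * l2) - b * (l1 * l2) + c * (l1 * l1))).
  by split; field.
exists u, w, (l1 * u + l2 * w)^-1; split; [by field|by field|].
move: eq0 => /eqP; rewrite addr_eq0 => /eqP <-.
by rewrite mulrC mulfK.
Qed.

(** Projection from the line [u1 = u2 = 0]: off that line, [(u1, u2)] determines [v1 = k / f] and
    [v2 = - k / g]. The curve meets the line in two points, at the roots of [f] and of [g]. The
    three nonvanishing hypotheses are the resultants of the pairs [(k, f)], [(k, g)] and
    [(f, g)]. *)
Lemma cubic_param (f1 f2 g1 g2 a b c u1 u2 v1 v2 : F) :
  let f s t := f1 * s + f2 * t in let g s t := g1 * s + g2 * t in
  let k s t := a * (s * s) + b * (s * t) + c * (t * t) in
  f u1 u2 * v1 = k u1 u2 -> g u1 u2 * v2 = - k u1 u2 ->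
  (u1 = 0 -> u2 = 0 -> v1 * v2 = 0) ->
  a * (f2 * f2) - b * (f1 * f2) + c * (f1 * f1) != 0 ->
  a * (g2 * g2) - b * (g1 * g2) + c * (g1 * g1) != 0 ->
  f1 * g2 - f2 * g1 != 0 ->
  exists s t r, [/\ u1 = r * (s * (f s t * g s t)), u2 = r * (t * (f s t * g s t)),
    v1 = r * (k s t * g s t) & v2 = r * (- k s t * f s t)].
Proof.
move=> f g k fk gk v0 kf kg det.
have [fn0|/andP[f0 g0]] : (f u1 u2 * g u1 u2 != 0) \/ (u1 == 0) && (u2 == 0).
  have [f0|fn0] := eqVneq (f u1 u2) 0.
    right; have k0 : k u1 u2 = 0 by rewrite -fk f0 mul0r.
    by have [-> ->] := linear_quadratic_zero f1 f2 a b c u1 u2 f0 k0 kf; rewrite eqxx.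
  have [g0|gn0] := eqVneq (g u1 u2) 0; last by left; rewrite mulf_neq0.
  right; have k0 : k u1 u2 = 0 by apply/eqP; rewrite -oppr_eq0 -gk g0 mul0r.
  by have [-> ->] := linear_quadratic_zero g1 g2 a b c u1 u2 g0 k0 kg; rewrite eqxx.
- have [fn gn] : f u1 u2 != 0 /\ g u1 u2 != 0.
    by move: fn0; rewrite mulf_eq0 negb_or => /andP.
  exists u1, u2, (f u1 u2 * g u1 u2)^-1; rewrite -fk.
  have -> : - (f u1 u2 * v1) = g u1 u2 * v2 by rewrite fk gk.
  by move: (f u1 u2) (g u1 u2) fn gn => x y xn yn; split; field; rewrite xn yn.
move/eqP: f0 => u10; move/eqP: g0 => u20; have /eqP := v0 u10 u20.
rewrite mulf_eq0 => /orP[/eqP v10|/eqP v20]; rewrite u10 u20.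
  (* At the root of [g] only the coordinate [- k * f] survives; the root of [f] treats the other
     point in the same way. *)
  exists g2, (- g1), (v2 / (- k g2 (- g1) * f g2 (- g1))).
  have -> : g g2 (- g1) = 0 by rewrite /g; ring.
  rewrite !mulr0 v10 divfK //; rewrite mulf_neq0 ?oppr_eq0 //.
    by move: kg; rewrite /k; apply: contraNneq => <-; apply/eqP; ring.
  by move: det; rewrite /f; apply: contraNneq => <-; apply/eqP; ring.
exists f2, (- f1), (v1 / (k f2 (- f1) * g f2 (- f1))).
have -> : f f2 (- f1) = 0 by rewrite /f; ring.
rewrite !(mulr0, mul0r) v20 divfK //; rewrite mulf_neq0 //.
  by move: kf; rewrite /k; apply: contraNneq => <-; apply/eqP; ring.
by move: det; rewrite -oppr_eq0 /g; apply: contraNneq => <-; apply/eqP; ring.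
Qed.

(** Applied to two of the four equations of [smooth4], it reduces smoothness to one nonzero minor of
    the Jacobian. *)
Lemma det2_kernel (a b p q p' q' : F) :
  a * p + b * q = 0 -> a * p' + b * q' = 0 -> p * q' - p' * q != 0 -> a = 0 /\ b = 0.
Proof.
move=> e e' nz; split; apply/eqP.
  suff: a * (p * q' - p' * q) == 0 by rewrite mulf_eq0 (negPf nz) orbF.
  apply/eqP; transitivity ((a * p + b * q) * q' - (a * p' + b * q') * q); first by ring.
  by rewrite e e' !mul0r subr0.
suff: b * (p * q' - p' * q) == 0 by rewrite mulf_eq0 (negPf nz) orbF.
apply/eqP; transitivity ((a * p' + b * q') * p - (a * p + b * q) * p'); first by ring.
by rewrite e e' !mul0r subr0.
Qed.

End RationalCurves.

(** * Explicit decompositions into lines, conics and twisted cubics *)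

Section Families.
Variable R : realType.
Local Open Scope complex_scope.
Local Notation C := (R[i]).

Ltac solve_realpoly :=
  repeat (cbv beta; match goal with
  | |- realpoly (fun s t => @?F s t + @?G s t) => apply: realpolyD
  | |- realpoly (fun s t => @?F s t * @?G s t) => apply: realpolyM
  | |- realpoly (fun s t => - @?F s t) => apply: realpolyN
  | |- realpoly (fun s t => s) => exact: realpoly_fst
  | |- realpoly (fun s t => t) => exact: realpoly_snd
  | |- realpoly (fun s t => _%:C) => exact: realpoly_cst
  | |- realpoly *%R => exact: realpolyM (realpoly_fst _) (realpoly_snd _)
  | |- realpoly (fun s t => 0) => exact: (realpoly_cst _ 0)
  end).

Lemma realC_neq0 (x : C) (r : R) : r != 0 -> x = r%:C -> x != 0.
Proof. by move=> r0 ->; rewrite fmorph_eq0. Qed.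

Lemma realC0 (r : R) : r != 0 -> r%:C != 0.
Proof. by move=> r0; rewrite fmorph_eq0. Qed.

(* [det M1 = (l1 x + l2 y) (k1 z + k2 w)]: a conic in each of the two planes. *)
Lemma uniformized_factored (l1 l2 k1 k2 n11 n12 n21 n22 : R) :
  l1 != 0 -> l2 != 0 -> k1 != 0 -> k2 != 0 -> n11 != 0 -> n22 != 0 ->
  n12 * n21 - n11 * n22 != 0 ->
  uniformized R (Coefs R (l1 * k1) (l1 * k2) (l2 * k1) (l2 * k2)) (Coefs R n11 n12 n21 n22).
Proof.
move=> l1n l2n k1n k2n n11n n22n detn.
(* Substituting [(x, y) = u (l2, - l1)] turns [det M2] into [z * L1 u w + q1 u w]; substituting
   [(z, w) = u (k2, - k1)] turns it into [x * L2 u y + q2 u y]. *)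
pose L1 s t : C := - (n21 * l1)%:C * s + n22%:C * t.
pose q1 s t : C := - (n11 * l1 * l2)%:C * (s * s) + (n12 * l2)%:C * (s * t).
pose L2 s t : C := - (n12 * k1)%:C * s + n11%:C * t.
pose q2 s t : C := - (n22 * k1 * k2)%:C * (s * s) + (n21 * k2)%:C * (s * t).
apply: (@uniformized2 _ _ _
  (Curve4 R (fun s t => l2%:C * (s * L1 s t)) (fun s t => - l1%:C * (s * L1 s t))
            (fun s t => - q1 s t) (fun s t => t * L1 s t))
  (Curve4 R (fun s t => - q2 s t) (fun s t => t * L2 s t)
            (fun s t => k2%:C * (s * L2 s t)) (fun s t => - k1%:C * (s * L2 s t)))).
- split=> /=; first by split; rewrite /L1 /q1; solve_realpoly.
    by move=> s t; rewrite /bil /L1 /q1 /=; split; ring.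
  exists 0, 1 => a b; rewrite /L1 /q1 /= => ex _ ez _.
  apply: (det2_kernel _ _ _ _ _ _ _ ex ez).
  apply: (@realC_neq0 _ (l1 * k2 * n22 * (n22 * n22))); last by ring.
  by rewrite !mulf_neq0.
- split=> /=; first by split; rewrite /L2 /q2; solve_realpoly.
    by move=> s t; rewrite /bil /L2 /q2 /=; split; ring.
  exists 0, 1 => a b; rewrite /L2 /q2 /= => ex _ _ ew.
  apply: (det2_kernel _ _ _ _ _ _ _ ew ex).
  apply: (@realC_neq0 _ (l2 * k2 * n11 * (n11 * n11))); last by ring.
  by rewrite !mulf_neq0.
move=> x y z w; rewrite /bil /= => Q1 Q2.
have /eqP : (l1%:C * x + l2%:C * y) * (k1%:C * z + k2%:C * w) = 0 by rewrite -[RHS]Q1; ring.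
rewrite mulf_eq0 => /orP[]; rewrite addrC addr_eq0 => /eqP E; [left|right].
  have ex : x = l2%:C * (x / l2%:C) by field; apply: realC0.
  have ey : y = - l1%:C * (x / l2%:C).
    by apply: (mulfI (realC0 _ l2n)); rewrite E; field; apply: realC0.
  move: (x / l2%:C) ex ey => u ex ey.
  have [||s [t [r [eu ew ez]]]] := @conic_param _ (- (n21 * l1)%:C) n22%:C
    (- (n11 * l1 * l2)%:C) (n12 * l2)%:C 0 u w z.
  - by rewrite -[RHS]Q2 ex ey; ring.
  - apply: (@realC_neq0 _ (l1 * l2 * n22 * (n12 * n21 - n11 * n22))); last by ring.
    by rewrite !mulf_neq0.
  exists s, t, r; rewrite /= /L1 /q1 ex ey ez eu [w]ew; split; ring.
have ez : z = k2%:C * (z / k2%:C) by field; apply: realC0.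
have ew : w = - k1%:C * (z / k2%:C).
  by apply: (mulfI (realC0 _ k2n)); rewrite E; field; apply: realC0.
move: (z / k2%:C) ez ew => u ez ew.
have [||s [t [r [eu ey ex]]]] := @conic_param _ (- (n12 * k1)%:C) n11%:C
  (- (n22 * k1 * k2)%:C) (n21 * k2)%:C 0 u y x.
- by rewrite -[RHS]Q2 ez ew; ring.
- apply: (@realC_neq0 _ (k1 * k2 * n11 * (n12 * n21 - n11 * n22))); last by ring.
  by rewrite !mulf_neq0.
exists s, t, r; rewrite /= /L2 /q2 ez ew ex eu [y]ey; split; ring.
Qed.

(* The line [y = w = 0] and a residual twisted cubic. *)
Lemma uniformized_m11_eq0 (m12 m21 m22 n11 n12 n21 n22 : R) :
  m12 != 0 -> m21 != 0 -> m22 != 0 -> n11 != 0 -> n12 != 0 -> n22 != 0 ->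
  n12 * n21 - n11 * n22 != 0 ->
  uniformized R (Coefs R 0 m12 m21 m22) (Coefs R n11 n12 n21 n22).
Proof.
move=> m12n m21n m22n n11n n12n n22n detn.
(* [f x z * y + g x z * w] is [m22 det M2], and eliminating [y z] gives [(n11 x + n21 z) det M1 -
   m21 z det M2 = w (f x z * y - k x z)]. *)
pose f s t : C := (m22 * n11)%:C * s + (m22 * n21)%:C * t.
pose g s t : C := (m22 * n12)%:C * s + (m22 * n22)%:C * t.
pose k s t : C := (- (m12 * n11))%:C * (s * s) + (m21 * n12 - m12 * n21)%:C * (s * t)
  + (m21 * n22)%:C * (t * t).
apply: (@uniformized2 _ _ _
  (Curve4 R (fun s t => s) (fun s t => 0) (fun s t => t) (fun s t => 0))
  (Curve4 R (fun s t => s * (f s t * g s t)) (fun s t => k s t * g s t)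
            (fun s t => t * (f s t * g s t)) (fun s t => - k s t * f s t))).
- split=> /=; first by split; solve_realpoly.
    by move=> s t; rewrite /bil /=; split; ring.
  exists 0, 1 => a b; rewrite /= => _ ey _ ew.
  apply: (det2_kernel _ _ _ _ _ _ _ ey ew).
  apply: (@realC_neq0 _ (m21 * n22)); last by ring.
  by rewrite !mulf_neq0.
- split=> /=; first by split; rewrite /f /g /k; solve_realpoly.
    by move=> s t; rewrite /bil /f /g /k /=; split; ring.
  exists 1, 0 => a b; rewrite /f /g /k /= => ex ey _ _.
  apply: (det2_kernel _ _ _ _ _ _ _ ex ey).
  apply: (@realC_neq0 _ (m22 * n11 * (m22 * n11) * (m12 * m12 * n11 * (n11 * m22 * n12)))); last by ring.
  by rewrite !mulf_neq0.
move=> x y z w; rewrite /bil /= => Q1 Q2.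
have [yw0|ywn] := boolP ((y == 0) && (w == 0)).
  by left; exists x, z, 1; move: yw0 => /andP[/eqP -> /eqP ->]; split; rewrite /=; ring.
right.
have [fk gk] : f x z * y = k x z /\ g x z * w = - k x z.
  have [w0|wn] := eqVneq w 0.
    have yn : y != 0 by move: ywn; rewrite w0 eqxx andbT.
    have z0 : z = 0.
      apply/eqP; suff: m21%:C * (y * z) == 0 by rewrite !mulf_eq0 (negPf yn) (negPf (realC0 _ m21n)).
      by rewrite -[X in _ == X]Q1 w0; apply/eqP; ring.
    have x0 : x = 0.
      apply/eqP; suff: n11%:C * (y * x) == 0 by rewrite !mulf_eq0 (negPf yn) (negPf (realC0 _ n11n)).
      by rewrite -[X in _ == X]Q2 w0 z0; apply/eqP; ring.
    by rewrite /f /g /k x0 z0 w0; split; ring.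
  have fk : f x z * y = k x z.
    apply: (mulfI wn); apply/eqP; rewrite -subr_eq0; apply/eqP.
    transitivity ((n11%:C * x + n21%:C * z) * 0 - m21%:C * z * 0 : C); last by ring.
    by rewrite -{1}Q1 -Q2 /f /k; ring.
  split=> //; rewrite -fk; apply/eqP; rewrite -addr_eq0; apply/eqP.
  by rewrite /f /g -[RHS](mulr0 m22%:C) -Q2; ring.
have [||||s [t [r [ex ez ey ew]]]] := @cubic_param _ _ _ _ _ _ _ _ x z y w fk gk.
- move=> x0 z0; apply/eqP; suff: m22%:C * (y * w) == 0 by rewrite mulf_eq0 (negPf (realC0 _ m22n)).
  by rewrite -[X in _ == X]Q1 x0 z0; apply/eqP; ring.
- apply: (@realC_neq0 _ (m21 * n11 * m22 * m22 * (n11 * n22 - n12 * n21))); last by ring.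
  by rewrite !mulf_neq0 // -opprB oppr_eq0.
- apply: (@realC_neq0 _ (m12 * n22 * m22 * m22 * (n12 * n21 - n11 * n22))); last by ring.
  by rewrite !mulf_neq0.
- apply: (@realC_neq0 _ (m22 * m22 * (n11 * n22 - n12 * n21))); last by ring.
  by rewrite !mulf_neq0 // -opprB oppr_eq0.
by exists s, t, r; split.
Qed.

(* The lines [x = y = 0] and [x = z = 0], and the residual conic, which lies in a
   plane since [n21 det M1 - m21 det M2] is divisible by [x]. *)
Lemma uniformized_m22_n22_eq0 (m11 m12 m21 n11 n12 n21 : R) :
  m11 != 0 -> m12 != 0 -> m21 != 0 -> n11 != 0 -> n12 != 0 -> n21 != 0 ->
  n21 * m12 - m21 * n12 != 0 ->
  uniformized R (Coefs R m11 m12 m21 0) (Coefs R n11 n12 n21 0).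
Proof.
move=> m11n m12n m21n n11n n12n n21n; set D := _ - _ => Dn.
(* The plane is [D w = m21 n11 y - n21 m11 z], and on it [D det M1 = m21 (x * L y z + q y z)]. The
   curve is scaled by [D] to keep [w] polynomial. *)
pose L s t : C := (m12 * n11)%:C * s + (- (n12 * m11))%:C * t.
pose q s t : C := D%:C * (s * t).
apply: (@uniformized3 _ _ _
  (Curve4 R (fun s t => 0) (fun s t => 0) (fun s t => s) (fun s t => t))
  (Curve4 R (fun s t => 0) (fun s t => s) (fun s t => 0) (fun s t => t))
  (Curve4 R (fun s t => - (D%:C * q s t)) (fun s t => D%:C * (s * L s t))
     (fun s t => D%:C * (t * L s t))
     (fun s t => ((m21 * n11)%:C * s - (n21 * m11)%:C * t) * L s t))).
- split=> /=; first by split; solve_realpoly.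
    by move=> s t; rewrite /bil /=; split; ring.
  exists 1, 0 => a b; rewrite /= => ex ey _ _.
  apply: (det2_kernel _ _ _ _ _ _ _ ex ey).
  apply: (@realC_neq0 _ (m11 * n21)); last by ring.
  by rewrite !mulf_neq0.
- split=> /=; first by split; solve_realpoly.
    by move=> s t; rewrite /bil /=; split; ring.
  exists 1, 0 => a b; rewrite /= => ex _ ez _.
  apply: (det2_kernel _ _ _ _ _ _ _ ez ex).
  apply: (@realC_neq0 _ (m21 * n11)); last by ring.
  by rewrite !mulf_neq0.
- split=> /=; first by split; rewrite /L /q; solve_realpoly.
    by move=> s t; rewrite /bil /L /q /D /=; split; ring.
  (* The root of [L] is the parameter of the coordinate point [(1 : 0 : 0 : 0)]. *)
  exists (n12 * m11), (m12 * n11) => a b; rewrite /L /q /= => _ ey ez _.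
  apply: (det2_kernel _ _ _ _ _ _ _ ez ey).
  apply: (@realC_neq0 _ (m11 * n11 * (D * D * (n12 * m11 * (m12 * n11)))
    * (D * D * (n12 * m11 * (m12 * n11))))); last by ring.
  by rewrite !mulf_neq0.
move=> x y z w; rewrite /bil /= => Q1 Q2.
have [x0|xn] := eqVneq x 0.
  have /eqP : m21%:C * (y * z) = 0 by rewrite -[RHS]Q1 x0; ring.
  rewrite !mulf_eq0 (negPf (realC0 _ m21n)) /= => /orP[/eqP y0|/eqP z0].
    by apply: Or31; exists z, w, 1; rewrite /= x0 y0; split; ring.
  by apply: Or32; exists y, w, 1; rewrite /= x0 z0; split; ring.
apply: Or33; have ew : D%:C * w = (m21 * n11)%:C * y - (n21 * m11)%:C * z.
  apply: (mulfI xn); apply/eqP; rewrite -subr_eq0; apply/eqP.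
  transitivity (n21%:C * 0 - m21%:C * 0 : C); last by ring.
  by rewrite -{1}Q1 -Q2 /D; ring.
have [||s [t [r [ey ez ex]]]] := @conic_param _ (m12 * n11)%:C (- (n12 * m11))%:C
    0 D%:C 0 y z x.
- apply: (mulfI (realC0 _ m21n)); transitivity (D%:C * 0
    - m12%:C * x * (D%:C * w - ((m21 * n11)%:C * y - (n21 * m11)%:C * z)) : C); last first.
    by rewrite ew; ring.
  by rewrite -[X in _ = _ * X - _]Q1 /D; ring.
- apply: (@realC_neq0 _ (D * (m12 * n11) * (n12 * m11))); last by ring.
  by rewrite !mulf_neq0.
have Dn' := realC0 _ Dn; exists s, t, (r / D%:C); split=> /=.
- by rewrite ex /q /L; field.
- by rewrite [y]ey /q /L; field.
- by rewrite [z]ez /q /L; field.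
by apply: (mulfI Dn'); rewrite ew [y]ey [z]ez /q /L; field.
Qed.

(* The line [x = w = 0] and a residual twisted cubic. *)
Lemma uniformized_m21_n21_eq0 (m11 m12 m22 n11 n12 n22 : R) :
  m11 != 0 -> m12 != 0 -> m22 != 0 -> n11 != 0 -> n12 != 0 -> n22 != 0 ->
  m11 * m22 * (n12 * n12) - n11 * n22 * (m12 * m12) != 0 ->
  uniformized R (Coefs R m11 m12 0 m22) (Coefs R n11 n12 0 n22).
Proof.
move=> m11n m12n m22n n11n n12n n22n; set E := _ - _ => En.
(* Eliminating [x w] gives [m12 det M2 - n12 det M1 = f y z * w + g y z * x], and [n11 y det M1 -
   m11 z det M2 = w (g y z * x + k y z)]. All three resultants of [f], [g], [k] are multiples of
   [E]. *)
pose f s t : C := (- (m22 * n12))%:C * s + (n22 * m12)%:C * t.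
pose g s t : C := (m12 * n11)%:C * s + (- (m11 * n12))%:C * t.
pose k s t : C := (m22 * n11)%:C * (s * s) + 0%:C * (s * t) + (- (m11 * n22))%:C * (t * t).
apply: (@uniformized2 _ _ _
  (Curve4 R (fun s t => 0) (fun s t => s) (fun s t => t) (fun s t => 0))
  (Curve4 R (fun s t => - k s t * f s t) (fun s t => s * (f s t * g s t))
            (fun s t => t * (f s t * g s t)) (fun s t => k s t * g s t))).
- split=> /=; first by split; solve_realpoly.
    by move=> s t; rewrite /bil /=; split; ring.
  exists 1, 0 => a b; rewrite /= => ex _ _ ew.
  apply: (det2_kernel _ _ _ _ _ _ _ ew ex).
  apply: (@realC_neq0 _ (m22 * n11)); last by ring.
  by rewrite !mulf_neq0.
- split=> /=; first by split; rewrite /f /g /k; solve_realpoly.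
    by move=> s t; rewrite /bil /f /g /k /=; split; ring.
  exists 1, 0 => a b; rewrite /f /g /k /= => ex ey _ _.
  apply: (det2_kernel _ _ _ _ _ _ _ ex ey).
  apply: (@realC_neq0 _ (m22 * n11 * (m22 * n11) * (m12 * m12 * n11 * (n11 * m22 * n12)))); last by ring.
  by rewrite !mulf_neq0.
move=> x y z w; rewrite /bil /= => Q1 Q2.
have [xw0|xwn] := boolP ((x == 0) && (w == 0)).
  by left; exists y, z, 1; move: xw0 => /andP[/eqP -> /eqP ->]; split; rewrite /=; ring.
right.
have [fk gk] : f y z * w = k y z /\ g y z * x = - k y z.
  have [w0|wn] := eqVneq w 0.
    have xn : x != 0 by move: xwn; rewrite w0 eqxx andbT.
    have z0 : z = 0.
      apply/eqP; suff: m11%:C * (x * z) == 0 by rewrite !mulf_eq0 (negPf xn) (negPf (realC0 _ m11n)).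
      by rewrite -[X in _ == X]Q1 w0; apply/eqP; ring.
    have y0 : y = 0.
      apply/eqP; suff: n11%:C * (x * y) == 0 by rewrite !mulf_eq0 (negPf xn) (negPf (realC0 _ n11n)).
      by rewrite -[X in _ == X]Q2 w0 z0; apply/eqP; ring.
    by rewrite /f /g /k y0 z0 w0; split; ring.
  have fk : f y z * w = k y z.
    apply: (mulfI wn); apply/eqP; rewrite -subr_eq0; apply/eqP.
    transitivity (- (n11%:C * y * 0 - m11%:C * z * 0 + w * (n12%:C * 0 - m12%:C * 0)) : C);
      last by ring.
    by rewrite -{1 3}Q1 -Q2 /f /k; ring.
  split=> //; rewrite -fk; apply/eqP; rewrite -addr_eq0; apply/eqP.
  transitivity (m12%:C * 0 - n12%:C * 0 : C); last by ring.
  by rewrite -{1}Q2 -Q1 /f /g; ring.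
have [||||s [t [r [ey ez ew ex]]]] := @cubic_param _ _ _ _ _ _ _ _ y z w x fk gk.
- move=> y0 z0; apply/eqP; suff: m12%:C * (w * x) == 0 by rewrite mulf_eq0 (negPf (realC0 _ m12n)).
  by rewrite -[X in _ == X]Q1 y0 z0; apply/eqP; ring.
- apply: (@realC_neq0 _ (- (m22 * n22 * E))); last by rewrite /E; ring.
  by rewrite oppr_eq0 !mulf_neq0.
- apply: (@realC_neq0 _ (m11 * n11 * E)); last by rewrite /E; ring.
  by rewrite !mulf_neq0.
- by apply: (@realC_neq0 _ E) => //; rewrite /E; ring.
by exists s, t, r; split.
Qed.

(* [c det M1 - det M2 = c (z - y) (m11 x - m22 w)]. *)
Lemma uniformized_proportional (c m11 m12 m21 m22 : R) :
  c != 0 -> m11 != 0 -> m12 != 0 -> m21 != 0 -> m22 != 0 ->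
  m12 * m21 - m11 * m22 != 0 ->
  uniformized R (Coefs R m11 m12 m21 m22) (Coefs R (c * m11) (c * m12) (c * m21) (c * m22)).
Proof.
move=> cn m11n m12n m21n m22n; set D := _ - _ => Dn.
(* On [y = z], [det M1] is [x * L1 y w + q1 y w]; on [(x, w) = u (m22, m11)] it is
   [z * L2 u y + q2 u y]. The smooth points below are at the roots of [L1] and [L2], again
   coordinate points. *)
pose L1 s t : C := m11%:C * s + m12%:C * t.
pose q1 s t : C := m21%:C * (s * s) + m22%:C * (s * t).
pose L2 s t : C := (m11 * m22)%:C * s + m21%:C * t.
pose q2 s t : C := (m11 * m22 * m12)%:C * (s * s) + (m11 * m22)%:C * (s * t).
apply: (@uniformized2 _ _ _
  (Curve4 R (fun s t => - q1 s t) (fun s t => s * L1 s t)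
            (fun s t => s * L1 s t) (fun s t => t * L1 s t))
  (Curve4 R (fun s t => m22%:C * (s * L2 s t)) (fun s t => t * L2 s t)
            (fun s t => - q2 s t) (fun s t => m11%:C * (s * L2 s t)))).
- split=> /=; first by split; rewrite /L1 /q1; solve_realpoly.
    by move=> s t; rewrite /bil /L1 /q1 /=; split; ring.
  exists m12, (- m11) => a b; rewrite /L1 /q1 /= => _ ey ez _.
  apply: (det2_kernel _ _ _ _ _ _ _ ez ey).
  apply: (@realC_neq0 _ (c * (m11 * m11) * (m12 * D * (m12 * D)))); last by rewrite /D; ring.
  by rewrite !mulf_neq0.
- split=> /=; first by split; rewrite /L2 /q2; solve_realpoly.
    by move=> s t; rewrite /bil /L2 /q2 /=; split; ring.
  exists m21, (- (m11 * m22)) => a b; rewrite /L2 /q2 /= => ex ey _ _.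
  apply: (det2_kernel _ _ _ _ _ _ _ ex ey).
  apply: (@realC_neq0 _ (c * m11 * m21 * (m11 * m22 * m21 * D * (m11 * m22 * m21 * D))));
    last by rewrite /D; ring.
  by rewrite !mulf_neq0.
move=> x y z w; rewrite /bil /= => Q1 Q2.
have /eqP : c%:C * ((z - y) * (m11%:C * x - m22%:C * w)) = 0.
  by transitivity (c%:C * 0 - 0 : C); [rewrite -{1}Q1 -Q2|]; ring.
rewrite !mulf_eq0 (negPf (realC0 _ cn)) /= => /orP[]; rewrite subr_eq0 => /eqP E; [left|right].
  have [||s [t [r [ey ew ex]]]] := @conic_param _ m11%:C m12%:C m21%:C m22%:C 0 y w x.
  - by rewrite -[RHS]Q1 E; ring.
  - apply: (@realC_neq0 _ (m12 * D)); last by rewrite /D; ring.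
    by rewrite !mulf_neq0.
  exists s, t, r; rewrite /= /L1 /q1 E ex [y]ey [w]ew; split; ring.
have ew : w = m11%:C * (w / m11%:C) by field; apply: realC0.
have ex : x = m22%:C * (w / m11%:C).
  by apply: (mulfI (realC0 _ m11n)); rewrite E; field; apply: realC0.
move: (w / m11%:C) ew ex => u ew ex.
have [||s [t [r [eu ey ez]]]] := @conic_param _ (m11 * m22)%:C m21%:C
  (m11 * m22 * m12)%:C (m11 * m22)%:C 0 u y z.
- by rewrite -[RHS]Q1 ew ex; ring.
- apply: (@realC_neq0 _ (m11 * m22 * m21 * D)); last by rewrite /D; ring.
  by rewrite !mulf_neq0.
exists s, t, r; rewrite /= /L2 /q2 ew ex ez eu [y]ey; split; ring.
Qed.

(* [c det M1 - det M2 = c (x - w) (m11 z - m22 y)]. *)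
Lemma uniformized_antiproportional (c m11 m12 m21 m22 : R) :
  c != 0 -> m11 != 0 -> m12 != 0 -> m21 != 0 -> m22 != 0 ->
  m12 * m21 - m11 * m22 != 0 ->
  uniformized R (Coefs R m11 m12 m21 m22) (Coefs R (c * m22) (c * m12) (c * m21) (c * m11)).
Proof.
move=> cn m11n m12n m21n m22n; set D := _ - _ => Dn.
(* On [x = w], [det M1] is [z * L1 x y + q1 x y]; on [(y, z) = u (m11, m22)] it is
   [w * L2 x u + q2 x u]. *)
pose L1 s t : C := m11%:C * s + m21%:C * t.
pose q1 s t : C := m12%:C * (s * s) + m22%:C * (s * t).
pose L2 s t : C := m12%:C * s + (m11 * m22)%:C * t.
pose q2 s t : C := (m11 * m22)%:C * (s * t) + (m11 * m22 * m21)%:C * (t * t).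
apply: (@uniformized2 _ _ _
  (Curve4 R (fun s t => s * L1 s t) (fun s t => t * L1 s t)
            (fun s t => - q1 s t) (fun s t => s * L1 s t))
  (Curve4 R (fun s t => s * L2 s t) (fun s t => m11%:C * (t * L2 s t))
            (fun s t => m22%:C * (t * L2 s t)) (fun s t => - q2 s t))).
- split=> /=; first by split; rewrite /L1 /q1; solve_realpoly.
    by move=> s t; rewrite /bil /L1 /q1 /=; split; ring.
  exists m21, (- m11) => a b; rewrite /L1 /q1 /= => ex ey _ _.
  apply: (det2_kernel _ _ _ _ _ _ _ ex ey).
  apply: (@realC_neq0 _ (c * m11 * m21 * (m21 * D * (m21 * D)))); last by rewrite /D; ring.
  by rewrite !mulf_neq0.
- split=> /=; first by split; rewrite /L2 /q2; solve_realpoly.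
    by move=> s t; rewrite /bil /L2 /q2 /=; split; ring.
  exists (m11 * m22), (- m12) => a b; rewrite /L2 /q2 /= => ex _ ez _.
  apply: (det2_kernel _ _ _ _ _ _ _ ex ez).
  apply: (@realC_neq0 _ (c * m12 * m11 * (m11 * m22 * m12 * D * (m11 * m22 * m12 * D))));
    last by rewrite /D; ring.
  by rewrite !mulf_neq0.
move=> x y z w; rewrite /bil /= => Q1 Q2.
have /eqP : c%:C * ((x - w) * (m22%:C * y - m11%:C * z)) = 0.
  by transitivity (0 - c%:C * 0 : C); [rewrite -{1}Q2 -Q1|]; ring.
rewrite !mulf_eq0 (negPf (realC0 _ cn)) /= => /orP[]; rewrite subr_eq0 => /eqP E; [left|right].
  have [||s [t [r [ex ey ez]]]] := @conic_param _ m11%:C m21%:C m12%:C m22%:C 0 x y z.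
  - by rewrite -[RHS]Q1 -E; ring.
  - apply: (@realC_neq0 _ (m21 * D)); last by rewrite /D; ring.
    by rewrite !mulf_neq0.
  exists s, t, r; rewrite /= /L1 /q1 -E ez [x]ex [y]ey; split; ring.
have ey : y = m11%:C * (y / m11%:C) by field; apply: realC0.
have ez : z = m22%:C * (y / m11%:C).
  by apply: (mulfI (realC0 _ m11n)); rewrite -E; field; apply: realC0.
move: (y / m11%:C) ey ez => u ey ez.
have [||s [t [r [ex eu ew]]]] := @conic_param _ m12%:C (m11 * m22)%:C
  0 (m11 * m22)%:C (m11 * m22 * m21)%:C x u w.
- by rewrite -[RHS]Q1 ey ez; ring.
- apply: (@realC_neq0 _ (m11 * m22 * m12 * D)); last by rewrite /D; ring.
  by rewrite !mulf_neq0.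
exists s, t, r; rewrite /= /L2 /q2 ey ez ew eu [x]ex; split; ring.
Qed.

(* On [det M1 = z f + w g = 0] write [(z, w) = r (g, - f)]; then
   [det M2 = - c (p' r - 1) (r f g + p x y)], whose factors cut out a line and a
   twisted cubic. *)
Lemma uniformized_line_cubic (c p p' m11 m12 m21 m22 : R) :
  c != 0 -> p != 0 -> p' != 0 -> m11 != 0 -> m12 != 0 -> m21 != 0 -> m22 != 0 ->
  p * p' = m11 * m22 - m12 * m21 ->
  uniformized R (Coefs R m11 m12 m21 m22) (Coefs R (c * p) (- (c * m12)) (c * m21) (c * p')).
Proof.
move=> cn pn p'n m11n m12n m21n m22n eD.
have eDC : p%:C * p'%:C - (m11%:C * m22%:C - m12%:C * m21%:C) = 0 :> C.
  by rewrite -!rmorphM eD; ring.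
have Dn : m11 * m22 - m12 * m21 != 0 by rewrite -eD mulf_neq0.
pose f s t : C := m11%:C * s + m21%:C * t.
pose g s t : C := m12%:C * s + m22%:C * t.
pose k s t : C := 0%:C * (s * s) + (- p)%:C * (s * t) + 0%:C * (t * t).
apply: (@uniformized2 _ _ _
  (Curve4 R (fun s t => p'%:C * s) (fun s t => p'%:C * t) (fun s t => g s t) (fun s t => - f s t))
  (Curve4 R (fun s t => s * (f s t * g s t)) (fun s t => t * (f s t * g s t))
            (fun s t => k s t * g s t) (fun s t => - k s t * f s t))).
- split=> /=; first by split; rewrite /f /g; solve_realpoly.
    move=> s t; rewrite /bil /f /g /=; split; first by ring.
    by rewrite -[RHS](mulr0 (c%:C * p'%:C * s * t)) -eDC; ring.
  exists 0, 1 => a b; rewrite /f /g /= => ex ey _ _.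
  apply: (det2_kernel _ _ _ _ _ _ _ ex ey).
  apply: (@realC_neq0 _ ((m11 * m22 - m12 * m21) * (c * m21 * m22))); last by ring.
  by rewrite !mulf_neq0.
- split=> /=; first by split; rewrite /f /g /k; solve_realpoly.
    move=> s t; rewrite /bil /f /g /k /=; split; first by ring.
    rewrite -[RHS](mulr0 (- (c%:C * p%:C * s * s * t * t * f s t * g s t))) -eDC /f /g; ring.
  exists 1, 0 => a b; rewrite /f /g /k /= => _ ey ez _.
  apply: (det2_kernel _ _ _ _ _ _ _ ez ey).
  apply: (@realC_neq0 _ (m11 * c * p * (m11 * m12 * (m11 * m12)))); last by ring.
  by rewrite !mulf_neq0.
move=> x y z w; rewrite /bil /= => Q1 Q2.
have onCubic : f x y * z = k x y -> g x y * w = - k x y -> hits R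
    (Curve4 R (fun s t => s * (f s t * g s t)) (fun s t => t * (f s t * g s t))
            (fun s t => k s t * g s t) (fun s t => - k s t * f s t)) x y z w.
  move=> fk gk.
  have [||||s [t [r [ex ey ez ew]]]] := @cubic_param _ _ _ _ _ _ _ _ x y z w fk gk.
  - move=> x0 y0; apply/eqP.
    suff: (c * p')%:C * (z * w) == 0 by rewrite mulf_eq0 (negPf (realC0 _ _)) // mulf_neq0.
    by rewrite -[X in _ == X]Q2 x0 y0; apply/eqP; ring.
  - apply: (@realC_neq0 _ (p * m11 * m21)); last by ring.
    by rewrite !mulf_neq0.
  - apply: (@realC_neq0 _ (p * m12 * m22)); last by ring.
    by rewrite !mulf_neq0.
  - by apply: (@realC_neq0 _ (m11 * m22 - m12 * m21)) => //; ring.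
  by exists s, t, r; split.
have zfwg : z * f x y + w * g x y = 0 by rewrite -[RHS]Q1 /f /g; ring.
(* When [x = y = 0], [f] and [g] vanish and [r] need not exist; such points satisfy the equations of
   the cubic trivially. *)
have [xy0|xyn] := boolP ((x == 0) && (y == 0)).
  right; move: xy0 => /andP[/eqP x0 /eqP y0].
  by apply: onCubic; rewrite /f /g /k x0 y0; ring.
have [r ez ew] : exists2 r, z = r * g x y & w = - (r * f x y).
  have [g0|gn] := eqVneq (g x y) 0; last first.
    exists (z / g x y); first by rewrite divfK.
    apply: (mulIf gn); apply/eqP; rewrite -subr_eq0; apply/eqP.
    by rewrite -[RHS]zfwg; field.
  have fn : f x y != 0.
    apply: contraNneq xyn => f0.
    have [||| -> ->] := @det2_kernel _ x y m11%:C m21%:C m12%:C m22%:C; rewrite ?eqxx //.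
    - by rewrite -[RHS]f0 /f; ring.
    - by rewrite -[RHS]g0 /g; ring.
    by apply: (@realC_neq0 _ (m11 * m22 - m12 * m21)) => //; ring.
  exists (- w / f x y); last by rewrite divfK // opprK.
  by move: zfwg; rewrite g0 !mulr0 addr0 => /eqP; rewrite mulf_eq0 (negPf fn) orbF => /eqP.
(* The quadratic in [r] factors because [m12 x f + m21 y g = f g - p p' x y], which is the relation
   between [p p'] and the determinant. *)
have /eqP : c%:C * ((p'%:C * r - 1) * (r * (f x y * g x y) + p%:C * (x * y))) = 0.
  transitivity (- (0 - c%:C * r * x * y * 0) : C); last by ring.
  by rewrite -{1}Q2 -eDC ez ew /f /g; ring.
rewrite !mulf_eq0 (negPf (realC0 _ cn)) /= => /orP[|] /eqP E; [left|right].
  have p'n' := realC0 _ p'n.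
  have er : r = p'%:C^-1.
    by apply: (mulfI p'n'); rewrite mulfV //; apply/eqP; rewrite -subr_eq0; apply/eqP.
  exists x, y, p'%:C^-1; rewrite /= ez ew er; split.
  - by field.
  - by field.
  - by [].
  by rewrite mulrN.
apply: onCubic.
  rewrite ez; apply/eqP; rewrite -subr_eq0; apply/eqP.
  by rewrite -[RHS]E /k; ring.
rewrite ew; apply/eqP; rewrite -subr_eq0 -oppr_eq0; apply/eqP.
by rewrite -[RHS]E /k; ring.
Qed.

End Families.

(** * Genericity as the nonvanishing of a polynomial in the eight payoffs *)

Section Genericity.
Variable R : realType.

Definition generically_real_dense (k : 'I_12) : Prop := exists g : {mpoly R[8]},
  (exists A B : 'M[R]_2, spohn_case k A B /\ g.@[payoff_vec A B] != 0) /\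
  (forall A B : 'M[R]_2, spohn_case k A B -> g.@[payoff_vec A B] != 0 ->
     (forall X, irr_component (spohn_var A B) X ->
        exists v, X v /\ spohn_smooth A B v /\ real_pt v) /\
     real_zdense (spohn_var A B)).

Definition payoff_poly (F : 'M[R]_2 -> 'M[R]_2 -> R) : Prop :=
  exists g : {mpoly R[8]}, forall A B, g.@[payoff_vec A B] = F A B.

Lemma payoff_polyB F G :
  payoff_poly F -> payoff_poly G -> payoff_poly (fun A B => F A B - G A B).
Proof. by move=> [f ef] [g eg]; exists (f - g) => A B; rewrite mevalB ef eg. Qed.

Lemma payoff_polyM F G :
  payoff_poly F -> payoff_poly G -> payoff_poly (fun A B => F A B * G A B).
Proof. by move=> [f ef] [g eg]; exists (f * g) => A B; rewrite mevalM ef eg. Qed.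

Lemma payoff_poly_entry (i : nat) : (i < 8)%N -> payoff_poly (fun A B =>
  nth 0 [:: e11 A; e12 A; e21 A; e22 A; e11 B; e12 B; e21 B; e22 B] i).
Proof. by move=> lt8; exists 'X_(inord i) => A B; rewrite mevalXU /payoff_vec inordK. Qed.

Lemma generic_case (k : 'I_12) F : payoff_poly F ->
  (exists A B, spohn_case k A B /\ F A B != 0) ->
  (forall A B, spohn_case k A B -> F A B != 0 -> uniformized R (coefs1 R A) (coefs2 R B)) ->
  generically_real_dense k.
Proof.
move=> [g eg] [A [B [kAB FAB]]] unif; exists g; split.
  by exists A, B; rewrite eg.
by move=> A' B' kAB'; rewrite eg => /(unif _ _ kAB'); apply: uniformized_dense.
Qed.

Definition mx2 (a b c d : R) : 'M[R]_2 :=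
  \matrix_(i < 2, j < 2) nth 0 (nth [::] [:: [:: a; b]; [:: c; d]] i) j.

Lemma mx2E a b c d : [/\ e11 (mx2 a b c d) = a, e12 (mx2 a b c d) = b,
  e21 (mx2 a b c d) = c & e22 (mx2 a b c d) = d].
Proof. by split; rewrite /e11 /e12 /e21 /e22 mxE. Qed.

End Genericity.

Arguments payoff_poly {R}.

Ltac solve_payoff_poly :=
  repeat (cbv beta; match goal with
  | |- payoff_poly (fun A B => @?F A B - @?G A B) => apply: payoff_polyB
  | |- payoff_poly (fun A B => @?F A B * @?G A B) => apply: payoff_polyM
  | |- payoff_poly (fun A B => e11 A) => exact: (payoff_poly_entry _ 0)
  | |- payoff_poly (fun A B => e12 A) => exact: (payoff_poly_entry _ 1)
  | |- payoff_poly (fun A B => e21 A) => exact: (payoff_poly_entry _ 2)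
  | |- payoff_poly (fun A B => e22 A) => exact: (payoff_poly_entry _ 3)
  | |- payoff_poly (fun A B => e11 B) => exact: (payoff_poly_entry _ 4)
  | |- payoff_poly (fun A B => e12 B) => exact: (payoff_poly_entry _ 5)
  | |- payoff_poly (fun A B => e21 B) => exact: (payoff_poly_entry _ 6)
  | |- payoff_poly (fun A B => e22 B) => exact: (payoff_poly_entry _ 7)
  end).

Ltac solve_witness a b c d a' b' c' d' :=
  exists (mx2 _ a b c d), (mx2 _ a' b' c' d'); rewrite /spohn_case /=;
  case: (mx2E _ a b c d) (mx2E _ a' b' c' d') => -> -> -> -> [-> -> -> ->];
  split; [by repeat split; ring | by apply/eqP => h; lra].

(** * The twelve cases, with their genericity polynomials and witnesses *)

Section Cases.
Variable R : realType.
Local Notation m := (coefs1 R).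
Local Notation n := (coefs2 R).
Local Notation c11 := (@c11 R).
Local Notation c12 := (@c12 R).
Local Notation c21 := (@c21 R).
Local Notation c22 := (@c22 R).

(** The determinant [c11 c22 - c12 c21] of the form [det M1] equals [(a11 - a12) (a21 - a22)], so
    [det M1] is reducible when one of these differences is zero. Here it has the factor [x + y]. *)
Lemma real_dense_case1 (lt : (0 < 12)%N) : generically_real_dense R (Ordinal lt).
Proof.
apply: (@generic_case _ _ (fun A B => c11 (m A) * c12 (m A) * c11 (n B) * c22 (n B)
  * (c12 (n B) * c21 (n B) - c11 (n B) * c22 (n B)))) => /=.
- solve_payoff_poly.
- solve_witness (0 : R) (0 : R) (1 : R) (2 : R) (0 : R) (1 : R) (3 : R) (7 : R).
move=> A B; rewrite /spohn_case /= => h.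
rewrite !(mulf_eq0, negb_or) => /andP[/andP[/andP[/andP[m11n m12n] n11n] n22n] detn].
have -> : m A = Coefs R (1 * (e21 A - e11 A)) (1 * (e22 A - e11 A))
    (1 * (e21 A - e11 A)) (1 * (e22 A - e11 A)).
  by rewrite /coefs1 h !mul1r.
by apply: uniformized_factored => //; apply: oner_neq0.
Qed.

Lemma real_dense_case2 (lt : (1 < 12)%N) : generically_real_dense R (Ordinal lt).
Proof.
apply: (@generic_case _ _ (fun A B => c12 (m A) * c21 (m A) * c22 (m A)
  * c11 (n B) * c12 (n B) * c22 (n B)
  * (c12 (n B) * c21 (n B) - c11 (n B) * c22 (n B)))) => /=.
- solve_payoff_poly.
- solve_witness (0 : R) (1 : R) (0 : R) (3 : R) (0 : R) (1 : R) (3 : R) (7 : R).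
move=> A B; rewrite /spohn_case /= => h.
rewrite !(mulf_eq0, negb_or).
move=> /andP[/andP[/andP[/andP[/andP[/andP[m12n m21n] m22n] n11n] n12n] n22n] detn].
have -> : m A = Coefs R 0 (e22 A - e11 A) (e21 A - e12 A) (e22 A - e12 A).
  by rewrite /coefs1 h subrr.
exact: uniformized_m11_eq0.
Qed.

(** Now the vanishing factor of the determinant is [a21 - a22], and [det M1] is divisible by
    [z + w]. *)
Lemma real_dense_case3 (lt : (2 < 12)%N) : generically_real_dense R (Ordinal lt).
Proof.
apply: (@generic_case _ _ (fun A B => c11 (m A) * c21 (m A) * c11 (n B) * c22 (n B)
  * (c12 (n B) * c21 (n B) - c11 (n B) * c22 (n B)))) => /=.
- solve_payoff_poly.
- solve_witness (0 : R) (1 : R) (3 : R) (3 : R) (0 : R) (1 : R) (3 : R) (7 : R).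
move=> A B; rewrite /spohn_case /= => h.
rewrite !(mulf_eq0, negb_or) => /andP[/andP[/andP[/andP[m11n m21n] n11n] n22n] detn].
have -> : m A = Coefs R ((e21 A - e11 A) * 1) ((e21 A - e11 A) * 1)
    ((e21 A - e12 A) * 1) ((e21 A - e12 A) * 1).
  by rewrite /coefs1 -h !mulr1.
by apply: uniformized_factored => //; apply: oner_neq0.
Qed.

Lemma real_dense_case4 (lt : (3 < 12)%N) : generically_real_dense R (Ordinal lt).
Proof.
apply: (@generic_case _ _ (fun A B => c12 (n B) * c21 (n B) * c22 (n B)
  * c11 (m A) * c12 (m A) * c22 (m A)
  * (c12 (m A) * c21 (m A) - c11 (m A) * c22 (m A)))) => /=.
- solve_payoff_poly.
- solve_witness (0 : R) (3 : R) (1 : R) (7 : R) (0 : R) (0 : R) (1 : R) (3 : R).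
move=> A B; rewrite /spohn_case /= => h.
rewrite !(mulf_eq0, negb_or).
move=> /andP[/andP[/andP[/andP[/andP[/andP[n12n n21n] n22n] m11n] m12n] m22n] detm].
apply: uniformized_swap.
have -> : n B = Coefs R 0 (e22 B - e11 B) (e12 B - e21 B) (e22 B - e21 B).
  by rewrite /coefs2 h subrr.
exact: uniformized_m11_eq0.
Qed.

Lemma real_dense_case5 (lt : (4 < 12)%N) : generically_real_dense R (Ordinal lt).
Proof.
apply: (@generic_case _ _ (fun A B => c11 (n B) * c12 (n B) * c11 (m A) * c22 (m A)
  * (c12 (m A) * c21 (m A) - c11 (m A) * c22 (m A)))) => /=.
- solve_payoff_poly.
- solve_witness (0 : R) (3 : R) (1 : R) (7 : R) (0 : R) (1 : R) (0 : R) (2 : R).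
move=> A B; rewrite /spohn_case /= => h.
rewrite !(mulf_eq0, negb_or) => /andP[/andP[/andP[/andP[n11n n12n] m11n] m22n] detm].
apply: uniformized_swap.
have -> : n B = Coefs R (1 * (e12 B - e11 B)) (1 * (e22 B - e11 B))
    (1 * (e12 B - e11 B)) (1 * (e22 B - e11 B)).
  by rewrite /coefs2 h !mul1r.
by apply: uniformized_factored => //; apply: oner_neq0.
Qed.

Lemma real_dense_case6 (lt : (5 < 12)%N) : generically_real_dense R (Ordinal lt).
Proof.
apply: (@generic_case _ _ (fun A B => c11 (n B) * c21 (n B) * c11 (m A) * c22 (m A)
  * (c12 (m A) * c21 (m A) - c11 (m A) * c22 (m A)))) => /=.
- solve_payoff_poly.
- solve_witness (0 : R) (3 : R) (1 : R) (7 : R) (0 : R) (3 : R) (1 : R) (3 : R).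
move=> A B; rewrite /spohn_case /= => h.
rewrite !(mulf_eq0, negb_or) => /andP[/andP[/andP[/andP[n11n n21n] m11n] m22n] detm].
apply: uniformized_swap.
have -> : n B = Coefs R ((e12 B - e11 B) * 1) ((e12 B - e11 B) * 1)
    ((e12 B - e21 B) * 1) ((e12 B - e21 B) * 1).
  by rewrite /coefs2 -h !mulr1.
by apply: uniformized_factored => //; apply: oner_neq0.
Qed.

Lemma real_dense_case7 (lt : (6 < 12)%N) : generically_real_dense R (Ordinal lt).
Proof.
apply: (@generic_case _ _ (fun A B => c11 (m A) * c12 (m A) * c21 (m A)
  * c11 (n B) * c12 (n B) * c21 (n B)
  * (c21 (n B) * c12 (m A) - c21 (m A) * c12 (n B)))) => /=.
- solve_payoff_poly.
- solve_witness (0 : R) (1 : R) (3 : R) (1 : R) (0 : R) (5 : R) (1 : R) (1 : R).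
move=> A B; rewrite /spohn_case /= => -[hA hB].
rewrite !(mulf_eq0, negb_or).
move=> /andP[/andP[/andP[/andP[/andP[/andP[m11n m12n] m21n] n11n] n12n] n21n] Dn].
have -> : m A = Coefs R (e21 A - e11 A) (e22 A - e11 A) (e21 A - e12 A) 0.
  by rewrite /coefs1 hA subrr.
have -> : n B = Coefs R (e12 B - e11 B) (e22 B - e11 B) (e12 B - e21 B) 0.
  by rewrite /coefs2 hB subrr.
exact: uniformized_m22_n22_eq0.
Qed.

Lemma real_dense_case8 (lt : (7 < 12)%N) : generically_real_dense R (Ordinal lt).
Proof.
apply: (@generic_case _ _ (fun A B => c11 (m A) * c12 (m A) * c22 (m A)
  * c11 (n B) * c12 (n B) * c22 (n B)
  * (c11 (m A) * c22 (m A) * (c12 (n B) * c12 (n B))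
     - c11 (n B) * c22 (n B) * (c12 (m A) * c12 (m A))))) => /=.
- solve_payoff_poly.
- solve_witness (0 : R) (1 : R) (1 : R) (3 : R) (0 : R) (1 : R) (1 : R) (4 : R).
move=> A B; rewrite /spohn_case /= => -[hA hB].
rewrite !(mulf_eq0, negb_or).
move=> /andP[/andP[/andP[/andP[/andP[/andP[m11n m12n] m22n] n11n] n12n] n22n] En].
have -> : m A = Coefs R (e21 A - e11 A) (e22 A - e11 A) 0 (e22 A - e12 A).
  by rewrite /coefs1 hA subrr.
have -> : n B = Coefs R (e12 B - e11 B) (e22 B - e11 B) 0 (e22 B - e21 B).
  by rewrite /coefs2 hB subrr.
exact: uniformized_m21_n21_eq0.
Qed.

(** Each equation says that three of the points [(a_ij, b_ji)] are collinear. Generically all four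
    lie on a line of slope [c], so the transpose of [B] is an affine function of [A] and the two
    forms are proportional. *)
Lemma real_dense_case9 (lt : (8 < 12)%N) : generically_real_dense R (Ordinal lt).
Proof.
apply: (@generic_case _ _ (fun A B => c11 (m A) * c12 (m A) * c21 (m A) * c22 (m A)
  * c21 (n B) * (c12 (m A) * c21 (m A) - c11 (m A) * c22 (m A)))) => /=.
- solve_payoff_poly.
- solve_witness (0 : R) (3 : R) (1 : R) (7 : R) (0 : R) (1 : R) (3 : R) (7 : R).
move=> A B; rewrite /spohn_case /coefs1 /coefs2 /=.
move: (e11 A) (e12 A) (e21 A) (e22 A) (e11 B) (e12 B) (e21 B) (e22 B).
move=> a11 a12 a21 a22 b11 b12 b21 b22 [h1 [h2 h3]].
rewrite !(mulf_eq0, negb_or).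
move=> /andP[/andP[/andP[/andP[/andP[m11n m12n] m21n] m22n] n21n] Dn].
have [c ec] : exists c, b12 - b21 = c * (a21 - a12).
  by exists ((b12 - b21) / (a21 - a12)); rewrite divfK.
have cn : c != 0 by apply: contraNneq n21n => c0; rewrite ec c0 mul0r.
have e22 : b22 - b21 = c * (a22 - a12).
  apply: (mulfI m21n); apply/eqP; rewrite -subr_eq0; apply/eqP.
  transitivity (0 + (a22 - a12) * (b12 - b21 - c * (a21 - a12))).
    by rewrite -h1; ring.
  by rewrite ec; ring.
have e12 : b22 - b11 = c * (a22 - a11).
  apply: (mulfI m22n); apply/eqP; rewrite -subr_eq0; apply/eqP.
  transitivity (0 + (a22 - a11) * (b22 - b21 - c * (a22 - a12))).
    by rewrite -h3; ring.
  by rewrite e22; ring.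
have e11 : b12 - b11 = c * (a21 - a11).
  apply: (mulfI m12n); apply/eqP; rewrite -subr_eq0; apply/eqP.
  transitivity (0 + (a21 - a11) * (b22 - b11 - c * (a22 - a11))).
    by rewrite -h2; ring.
  by rewrite e12; ring.
by rewrite e11 e12 ec e22; apply: uniformized_proportional.
Qed.

(** The collinear points are now [(a11, b22)], [(a12, b12)], [(a21, b21)], [(a22, b11)], on a line
    of slope [- c]. *)
Lemma real_dense_case10 (lt : (9 < 12)%N) : generically_real_dense R (Ordinal lt).
Proof.
apply: (@generic_case _ _ (fun A B => c11 (m A) * c12 (m A) * c21 (m A) * c22 (m A)
  * c21 (n B) * (c12 (m A) * c21 (m A) - c11 (m A) * c22 (m A)))) => /=.
- solve_payoff_poly.
- solve_witness (0 : R) (3 : R) (1 : R) (7 : R) (0 : R) (4 : R) (6 : R) (7 : R).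
move=> A B; rewrite /spohn_case /coefs1 /coefs2 /=.
move: (e11 A) (e12 A) (e21 A) (e22 A) (e11 B) (e12 B) (e21 B) (e22 B).
move=> a11 a12 a21 a22 b11 b12 b21 b22 [h1 [h2 h3]].
rewrite !(mulf_eq0, negb_or).
move=> /andP[/andP[/andP[/andP[/andP[m11n m12n] m21n] m22n] n21n] Dn].
have [c ec] : exists c, b12 - b21 = c * (a21 - a12).
  by exists ((b12 - b21) / (a21 - a12)); rewrite divfK.
have cn : c != 0 by apply: contraNneq n21n => c0; rewrite ec c0 mul0r.
have e22 : b22 - b21 = c * (a21 - a11).
  apply: (mulfI m21n); apply/eqP; rewrite -subr_eq0; apply/eqP.
  transitivity (0 + (a21 - a11) * (b12 - b21 - c * (a21 - a12))).
    by rewrite -h1; ring.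
  by rewrite ec; ring.
have e11 : b12 - b11 = c * (a22 - a12).
  apply: (mulfI m21n); apply/eqP; rewrite -subr_eq0; apply/eqP.
  transitivity (0 + (a22 - a12) * (b12 - b21 - c * (a21 - a12))).
    by rewrite -h2; ring.
  by rewrite ec; ring.
have e12 : b22 - b11 = c * (a22 - a11).
  apply: (mulfI m11n); apply/eqP; rewrite -subr_eq0; apply/eqP.
  transitivity (0 + (a22 - a11) * (b22 - b21 - c * (a21 - a11))).
    by rewrite -h3; ring.
  by rewrite e22; ring.
by rewrite e11 e12 ec e22; apply: uniformized_antiproportional.
Qed.

(** The points [(a_ij, b_ij)] lie on a line of slope [- c]; for [c = 1] the game is constant-sum,
    and the witness is the zero-sum game [B = - A]. *)
Lemma real_dense_case11 (lt : (10 < 12)%N) : generically_real_dense R (Ordinal lt).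
Proof.
apply: (@generic_case _ _ (fun A B => c11 (m A) * c12 (m A) * c21 (m A) * c22 (m A)
  * c11 (n B) * c21 (n B) * c22 (n B))) => /=.
- solve_payoff_poly.
- solve_witness (0 : R) (3 : R) (1 : R) (7 : R) (0 : R) (- 3 : R) (- 1 : R) (- 7 : R).
move=> A B; rewrite /spohn_case /coefs1 /coefs2 /=.
move: (e11 A) (e12 A) (e21 A) (e22 A) (e11 B) (e12 B) (e21 B) (e22 B).
move=> a11 a12 a21 a22 b11 b12 b21 b22 [h1 [h2 h3]].
rewrite !(mulf_eq0, negb_or).
move=> /andP[/andP[/andP[/andP[/andP[/andP[m11n m12n] m21n] m22n] n11n] n21n] n22n].
have [c ec] : exists c, b12 - b21 = c * (a21 - a12).
  by exists ((b12 - b21) / (a21 - a12)); rewrite divfK.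
have cn : c != 0 by apply: contraNneq n21n => c0; rewrite ec c0 mul0r.
have e22 : b22 - b21 = c * (a21 - a22).
  apply: (mulfI m21n); apply/eqP; rewrite -subr_eq0; apply/eqP.
  transitivity ((a21 - a22) * (b12 - b21 - c * (a21 - a12)) - 0).
    by rewrite -h1; ring.
  by rewrite ec; ring.
have e12 : b22 - b11 = - (c * (a22 - a11)).
  apply: (mulfI m22n); apply/eqP; rewrite -subr_eq0; apply/eqP.
  transitivity (0 - (a22 - a11) * (b12 - b21 - c * (a21 - a12))
    + (a22 - a11) * (b22 - b21 - c * (a21 - a22))).
    by rewrite -h3; ring.
  by rewrite ec e22; ring.
have e11 : b12 - b11 = c * (a11 - a12).
  transitivity (b22 - b11 - (b22 - b21) + (b12 - b21)); first by ring.
  by rewrite e12 e22 ec; ring.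
(* Here [p = a11 - a12] and [p' = a21 - a22], the two factors of the determinant of [det M1]. *)
rewrite e11 e12 ec e22; apply: uniformized_line_cubic => //; last by ring.
  by apply: contraNneq n11n => p0; rewrite e11 p0 mulr0.
by apply: contraNneq n22n => p0; rewrite e22 p0 mulr0.
Qed.

(** The points [(a11, b22)], [(a12, b21)], [(a21, b12)], [(a22, b11)] lie on a line of slope [c]. *)
Lemma real_dense_case12 (lt : (11 < 12)%N) : generically_real_dense R (Ordinal lt).
Proof.
apply: (@generic_case _ _ (fun A B => c11 (m A) * c12 (m A) * c21 (m A) * c22 (m A)
  * c11 (n B) * c21 (n B) * c22 (n B))) => /=.
- solve_payoff_poly.
- solve_witness (0 : R) (3 : R) (1 : R) (7 : R) (0 : R) (- 6 : R) (- 4 : R) (- 7 : R).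
move=> A B; rewrite /spohn_case /coefs1 /coefs2 /=.
move: (e11 A) (e12 A) (e21 A) (e22 A) (e11 B) (e12 B) (e21 B) (e22 B).
move=> a11 a12 a21 a22 b11 b12 b21 b22 [h1 [h2 h3]].
rewrite !(mulf_eq0, negb_or).
move=> /andP[/andP[/andP[/andP[/andP[/andP[m11n m12n] m21n] m22n] n11n] n21n] n22n].
have [c ec] : exists c, b12 - b21 = c * (a21 - a12).
  by exists ((b12 - b21) / (a21 - a12)); rewrite divfK.
have cn : c != 0 by apply: contraNneq n21n => c0; rewrite ec c0 mul0r.
have e22 : b22 - b21 = c * (a11 - a12).
  apply: (mulfI m21n); apply/eqP; rewrite -subr_eq0; apply/eqP.
  transitivity ((a11 - a12) * (b12 - b21 - c * (a21 - a12)) - 0).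
    by rewrite -h1; ring.
  by rewrite ec; ring.
have e11 : b12 - b11 = c * (a21 - a22).
  apply: (mulfI m21n); apply/eqP; rewrite -subr_eq0; apply/eqP.
  transitivity ((a21 - a22) * (b12 - b21 - c * (a21 - a12)) + 0).
    by rewrite -h2; ring.
  by rewrite ec; ring.
have e12 : b22 - b11 = - (c * (a22 - a11)).
  transitivity (b12 - b11 + (b22 - b21) - (b12 - b21)); first by ring.
  by rewrite e11 e22 ec; ring.
(* The factors of the determinant exchange roles: [p = a21 - a22] and [p' = a11 - a12]. *)
rewrite e11 e12 ec e22; apply: uniformized_line_cubic => //; last by ring.
  by apply: contraNneq n11n => p0; rewrite e11 p0 mulr0.
by apply: contraNneq n22n => p0; rewrite e22 p0 mulr0.
Qed.

End Cases.

(* For each case k (case (k+1) of the paper), there is a real polynomial g in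
   the 8 payoff entries, not identically zero on the real variety W_k of the
   case, such that for every (A,B) in W_k with g(A,B) <> 0 the conclusion
   holds. *)
Theorem theorem3p7 (R : realType) (k : 'I_12) :
  exists g : {mpoly R[8]},
    (exists A B : 'M[R]_2, spohn_case k A B /\ g.@[payoff_vec A B] != 0) /\
    (forall A B : 'M[R]_2, spohn_case k A B -> g.@[payoff_vec A B] != 0 ->
       (forall X, irr_component (spohn_var A B) X ->
          exists v, X v /\ spohn_smooth A B v /\ real_pt v) /\
       real_zdense (spohn_var A B)).
Proof.
case: k => -[|[|[|[|[|[|[|[|[|[|[|[|//]]]]]]]]]]]] lt.
- exact: real_dense_case1.
- exact: real_dense_case2.
- exact: real_dense_case3.
- exact: real_dense_case4.
- exact: real_dense_case5.
- exact: real_dense_case6.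
- exact: real_dense_case7.
- exact: real_dense_case8.
- exact: real_dense_case9.
- exact: real_dense_case10.
- exact: real_dense_case11.
- exact: real_dense_case12.
Qed.
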